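(* Let $m,n,r,d$ be integers with $m,n\ge2$, $d\ge1$ and $0<r<\min\{m,n\}$, and for $0\le a\le rd$ let $d_R=\lfloor a/r\rfloor$, $t_R=a\bmod r$, $\alpha=\lfloor a/(n-r)\rfloor$, $s=a\bmod(n-r)$, $\beta=\lfloor (rd-a)/(m-r)\rfloor$, $t=(rd-a)\bmod(m-r)$. Let $\mathcal{B}_a$ be the set of products $L(\lambda)R(\lambda)$ with $L\in\mathbb{C}[\lambda]^{m\times r}$, $R\in\mathbb{C}[\lambda]^{r\times n}$, $\deg(R_{i*})=d_R+1$ for $1\le i\le t_R$, $\deg(R_{i*})=d_R$ for $t_R<i\le r$, and $\deg(L_{*i})=d-\deg(R_{i*})$ for $1\le i\le r$. Let $\mathcal{M}_a$ be the set of products $L(\lambda)R(\lambda)$ with factors $L,R$ satisfying these same conditions and additionally such that the columns of $L$ form a minimal basis and the rows of $R$ form a minimal basis. Let $\mathcal{MH}_a$ be the set of products $L(\lambda)R(\lambda)$ with factors $L,R$ satisfying the conditions defining $\mathcal{M}_a$ and additionally such that the left nullspace $\mathcal{N}_\ell(L)$ has minimal indices $\beta+1$ ($t$ times) and $\beta$ ($m-r-t$ times), and the right nullspace $\mathcal{N}_r(R)$ has minimal indices $\alpha+1$ ($s$ times) and $\alpha$ ($n-r-s$ times). Then: (i) $\mathcal{MH}_a\subseteq\mathcal{M}_a\subseteq\mathcal{B}_a$ for $a=0,\dots,rd$; (ii) $\overline{\mathcal{MH}_a}=\overline{\mathcal{M}_a}=\overline{\mathcal{B}_a}$ for $a=0,\dots,rd$;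 (iii) $\mathbb{C}[\lambda]^{m\times n}_{d,r}=\bigcup_{0\le a\le rd}\overline{\mathcal{MH}_a}=\bigcup_{0\le a\le rd}\overline{\mathcal{M}_a}$; (iv) for every $P(\lambda)\in\mathbb{C}[\lambda]^{m\times n}_{d,r}$ there is an integer $a$ with $P(\lambda)\in\overline{\mathcal{MH}_a}=\overline{\mathcal{M}_a}$.
   Context: $\mathbb{C}[\lambda]^{m\times n}_{d,r}$ is the set of complex $m\times n$ polynomial matrices of degree at most $d$ and normal rank (rank over $\mathbb{C}(\lambda)$) at most $r$. Degrees of polynomial vectors are the maximum degree of entries, $\deg 0=-\infty$; $L_{*i}$ is the $i$th column of $L$, $R_{i*}$ the $i$th row of $R$. A minimal basis of a rational subspace (subspace of $\mathbb{C}(\lambda)^k$) is a basis of polynomial vectors with minimal sum of degrees among polynomial bases; the minimal indices of the subspace are the degrees of the vectors in any minimal basis (this list is independent of the minimal basis). $\mathcal{N}_\ell(L)=\{y\in\mathbb{C}(\lambda)^{1\times m}: yL=0\}$, $\mathcal{N}_r(R)=\{x\in\mathbb{C}(\lambda)^{n\times1}:Rx=0\}$. Closures are taken in $\mathbb{C}[\lambda]^{m\times n}_d$ (polynomial matrices of degree at most $d$) with the metric $\mathrm{dist}(P,Q)=(\sum_{i=0}^d\|P_i-Q_i\|_F^2)^{1/2}$, where $P_i,Q_i$ are the coefficients of $\lambda^i$. *)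

(* Defs.v *)
From HB Require Import structures.
From mathcomp Require Import all_boot all_order all_algebra.
From mathcomp Require Import fraction.
From mathcomp.real_closed Require Import complex.
From mathcomp Require Import Rstruct.
From Stdlib Require Import Rdefinitions.

Set Implicit Arguments.
Unset Strict Implicit.
Unset Printing Implicit Defensive.

Import Order.TTheory GRing.Theory Num.Theory.
Local Open Scope ring_scope.

Notation C := ((Rdefinitions.R)[i]) (only parsing).

Definition polyC := {poly C}.
Definition ratC := {fraction {poly C}}.

Definition fracmx (p q : nat) (A : 'M[{poly C}]_(p, q)) : 'M[ratC]_(p, q) :=
  map_mx (@tofrac _) A.

(* msize A = 1 + max degree of the entries of A (0 if A = 0); for a row or
   column vector v, the degree of v is (msize v).-1 when v != 0. *)
Definition msize (p q : nat) (A : 'M[{poly C}]_(p, q)) : nat :=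
  \max_(i < p) \max_(j < q) size (A i j).

(* "deg v = k" for a polynomial vector v and k a natural number
   (deg 0 = -oo never equals a natural number). *)
Definition has_deg (p q : nat) (v : 'M[{poly C}]_(p, q)) (k : nat) : Prop :=
  msize v = k.+1.

Definition vdeg (p q : nat) (v : 'M[{poly C}]_(p, q)) : nat := (msize v).-1.

Definition row_degs (k q : nat) (B : 'M[{poly C}]_(k, q)) : seq nat :=
  [seq vdeg (row i B) | i <- enum 'I_k].

Definition sum_row_degs (k q : nat) (B : 'M[{poly C}]_(k, q)) : nat :=
  \sum_(i < k) vdeg (row i B).

(* The rows of the polynomial matrix B form a minimal basis of the rational
   subspace of C(lambda)^q spanned by the rows of S: they form a basis
   (linearly independent over C(lambda), spanning the row space of S) and
   have minimal degree sum among all polynomial bases of that subspace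
   (every basis has exactly k = dim vectors). *)
Definition is_min_basis_of (k q s : nat) (B : 'M[{poly C}]_(k, q))
    (S : 'M[ratC]_(s, q)) : Prop :=
  [/\ row_free (fracmx B), (fracmx B == S)%MS &
      forall B' : 'M[{poly C}]_(k, q),
        row_free (fracmx B') -> (fracmx B' == S)%MS ->
        leq (sum_row_degs B) (sum_row_degs B')].

Definition rows_min_basis (k q : nat) (B : 'M[{poly C}]_(k, q)) : Prop :=
  is_min_basis_of B (fracmx B).

(* The rational subspace spanned by the rows of S has minimal indices given
   (as a multiset) by the list ix: some (equivalently, every) minimal basis
   has degrees ix, up to order. *)
Definition min_indices (q s : nat) (S : 'M[ratC]_(s, q)) (ix : seq nat) : Prop :=
  exists B : 'M[{poly C}]_(size ix, q),
    is_min_basis_of B S /\ perm_eq (row_degs B) ix.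

Definition left_null (m r : nat) (L : 'M[{poly C}]_(m, r)) : 'M[ratC]_m :=
  kermx (fracmx L).

(* Right nullspace N_r(R) = {x in C(lambda)^{n x 1} : R x = 0}, represented
   by the transposed vectors x^T, as the row space of a matrix. *)
Definition right_null (r n : nat) (R : 'M[{poly C}]_(r, n)) : 'M[ratC]_n :=
  kermx (fracmx R)^T.

Definition normal_rank (m n : nat) (P : 'M[{poly C}]_(m, n)) : nat :=
  \rank (fracmx P).

Definition deg_le (m n : nat) (P : 'M[{poly C}]_(m, n)) (d : nat) : Prop :=
  forall i j, leq (size (P i j)) d.+1.

Definition PolyMat_dr (m n d r : nat) (P : 'M[{poly C}]_(m, n)) : Prop :=
  deg_le P d /\ leq (normal_rank P) r.

Definition pdist (m n d : nat) (P Q : 'M[{poly C}]_(m, n)) : Rdefinitions.R :=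
  Num.sqrt (\sum_(k < d.+1) \sum_(i < m) \sum_(j < n)
              (ComplexField.Normc.normc ((P i j)`_k - (Q i j)`_k)) ^+ 2).

Definition closure_d (m n d : nat) (S : 'M[{poly C}]_(m, n) -> Prop)
    (P : 'M[{poly C}]_(m, n)) : Prop :=
  deg_le P d /\
  forall eps : Rdefinitions.R, 0 < eps ->
    exists Q, S Q /\ pdist d P Q < eps.

Definition dR (r a : nat) : nat := divn a r.
Definition tR (r a : nat) : nat := modn a r.

Definition deg_conds (m n r d a : nat) (L : 'M[{poly C}]_(m, r))
    (R : 'M[{poly C}]_(r, n)) : Prop :=
  forall i : 'I_r,
    let degRi := if ltn i (tR r a) then (dR r a).+1 else dR r a in
    has_deg (row i R) degRi /\ has_deg (col i L) (subn d degRi).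

Definition Bset (m n r d a : nat) (P : 'M[{poly C}]_(m, n)) : Prop :=
  exists (L : 'M[{poly C}]_(m, r)) (R : 'M[{poly C}]_(r, n)),
    deg_conds d a L R /\ P = L *m R.

Definition Mset (m n r d a : nat) (P : 'M[{poly C}]_(m, n)) : Prop :=
  exists (L : 'M[{poly C}]_(m, r)) (R : 'M[{poly C}]_(r, n)),
    [/\ deg_conds d a L R, rows_min_basis L^T, rows_min_basis R & P = L *m R].

Definition MHset (m n r d a : nat) (P : 'M[{poly C}]_(m, n)) : Prop :=
  let alpha := divn a (subn n r) in
  let s := modn a (subn n r) in
  let beta := divn (subn (muln r d) a) (subn m r) in
  let t := modn (subn (muln r d) a) (subn m r) in
  exists (L : 'M[{poly C}]_(m, r)) (R : 'M[{poly C}]_(r, n)),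
    [/\ deg_conds d a L R, rows_min_basis L^T, rows_min_basis R,
        min_indices (left_null L) (nseq t beta.+1 ++ nseq (subn (subn m r) t) beta) /\
        min_indices (right_null R) (nseq s alpha.+1 ++ nseq (subn (subn n r) s) alpha)
      & P = L *m R].

(* Main.v *)
Require Import Defs.
From HB Require Import structures.
From mathcomp Require Import all_boot all_order all_algebra.
From mathcomp Require Import fraction perm.
From mathcomp.real_closed Require Import complex.
From mathcomp Require Import Rstruct.
From mathcomp Require Import zify ring.

Set Implicit Arguments.
Unset Strict Implicit.
Unset Printing Implicit Defensive.

Import Order.TTheory GRing.Theory Num.Theory.
Local Open Scope ring_scope.

(* A matrix of normal rank at most r factors as L R with deg R_i* = e_i and
   deg L_*i <= d - e_i: take for R a polynomial basis of a space containing the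
   rows of P with the sum of its row degrees minimal; minimality makes L
   polynomial and gives the degree bounds.  A rational curve through L R moves
   one unit of degree from e_i to e_j whenever e_i > e_j, so up to closure the
   e_i can be taken balanced with the same sum a.
   For a factor R with row degrees e_i of sum a, put N = n - r and
   alpha = floor (a / N).  Everything that MH_a requires of R follows from two
   conditions on x |-> R x: it is injective on vectors of degree < alpha, and it
   maps the vectors of degree <= alpha onto those with i-th entry of degree
   <= e_i + alpha.  Both are full rank conditions on matrices depending linearly on
   R, and an explicit bidiagonal R satisfies them, so they hold at all but
   finitely many points of the line through any given R and that one; likewise
   for L^T.  Hence B_a lies in the closure of MH_a.  Conversely limits of
   products L R have rank at most r, since a constant matrix near an invertible
   scalar matrix is invertible. *)

(** * Coefficientwise approximation and its relation to [closure_d] *)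

Section Approximation.

Local Open Scope complex_scope.

(** Here [eps] is a positive element of the complex field, hence a positive real. All coefficients
    are compared, so no degree bound enters. *)
Definition approx (m n : nat) (S : 'M[{poly C}]_(m, n) -> Prop)
    (P : 'M[{poly C}]_(m, n)) : Prop :=
  forall eps : C, 0 < eps ->
    exists2 Q, S Q & forall i j k, `|(P i j)`_k - (Q i j)`_k| < eps.

Lemma normC_normc (x : C) : `|x| = (ComplexField.Normc.normc x)%:C.
Proof. by rewrite normc_def; case: x. Qed.

Lemma normc_ge0 (x : C) : 0 <= ComplexField.Normc.normc x.
Proof. by rewrite -ler0c -normC_normc. Qed.

Lemma approx_trans m n (S T : 'M[{poly C}]_(m, n) -> Prop) P :
  approx S P -> (forall Q, S Q -> approx T Q) -> approx T P.
Proof.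
move=> hS hT eps e0; have e2 : 0 < eps / 2 by rewrite divr_gt0.
have [Q SQ hQ] := hS _ e2; have [Q' TQ' hQ'] := hT _ SQ _ e2.
exists Q' => // i j k.
have -> : (P i j)`_k - (Q' i j)`_k =
  ((P i j)`_k - (Q i j)`_k) + ((Q i j)`_k - (Q' i j)`_k) by ring.
by apply: le_lt_trans (ler_normD _ _) _; rewrite [eps]splitr ltrD.
Qed.

Lemma approx_id m n (S : 'M[{poly C}]_(m, n) -> Prop) P : S P -> approx S P.
Proof. by move=> SP eps e0; exists P => // i j k; rewrite subrr normr0. Qed.

Lemma closure_approx m n d (S : 'M[{poly C}]_(m, n) -> Prop) P :
  (forall Q, S Q -> deg_le Q d) -> closure_d d S P -> approx S P.
Proof.
move=> dS [dP hP] eps e0.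
have epsE : eps = (complex.Re eps)%:C by rewrite RRe_real ?gtr0_real.
have e0' : 0 < complex.Re eps by rewrite -ltcR -epsE.
have [Q [SQ hQ]] := hP _ e0'; exists Q => // i j k.
have [kd|kd] := ltnP k d.+1; last first.
  rewrite !nth_default ?subrr ?normr0 //; first exact: leq_trans (dS _ SQ i j) kd.
  exact: leq_trans (dP i j) kd.
rewrite epsE normC_normc ltcR; apply: le_lt_trans hQ.
set z := ComplexField.Normc.normc _.
have z0 : 0 <= z by apply: normc_ge0.
rewrite -(ger0_norm z0) -sqrtr_sqr /pdist; apply: ler_wsqrtr.
rewrite (bigD1 (Ordinal kd)) //= (bigD1 i) //= (bigD1 j) //= -/z -!addrA lerDl.
by rewrite !addr_ge0 ?sumr_ge0 // => *; rewrite ?sqr_ge0 // ?sumr_ge0 // => *;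
   rewrite ?sqr_ge0 // ?sumr_ge0 // => *; rewrite sqr_ge0.
Qed.

Lemma approx_closure m n d (S : 'M[{poly C}]_(m, n) -> Prop) P :
  deg_le P d -> approx S P -> closure_d d S P.
Proof.
move=> dP hP; split=> // eps e0.
(* The sum in [pdist] has [N - 1] terms. If each difference is below [eps / N], the sum of squares
   is at most (N - 1) eps^2 / N^2, which is less than eps^2. *)
pose N : Rdefinitions.R := (d.+1 * m * n).+1%:R.
have N0 : 0 < N by rewrite ltr0n.
have N1 : 1 <= N by rewrite ler1n.
have d0 : 0 < (eps / N)%:C by rewrite -[0]/(0%:C) ltcR divr_gt0.
have [Q SQ hQ] := hP _ d0; exists Q; split=> //.
rewrite /pdist -[ltRHS](gtr0_norm e0) -sqrtr_sqr ltr_sqrt ?exprn_gt0 //.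
apply: (@le_lt_trans _ _ (\sum_(k < d.+1) \sum_(i < m) \sum_(j < n) (eps / N) ^+ 2)).
  do 3!(apply: ler_sum => ? _); rewrite ler_sqr ?nnegrE ?normc_ge0 ?ltW ?divr_gt0 //.
  by rewrite -ltcR -normC_normc.
rewrite !sumr_const !card_ord -!mulrnA exprMn -[_ *+ _]mulr_natr -mulrA.
rewrite gtr_pMr ?exprn_gt0 // exprVn mulrC ltr_pdivrMr ?exprn_gt0 // mul1r.
apply: (@lt_le_trans _ _ N); first by rewrite ltr_nat; lia.
by rewrite expr2 ler_peMl // ltW.
Qed.

Lemma coef_bound m n (A : 'M[{poly C}]_(m, n)) :
  exists2 M : C, 0 < M & forall i j k, `|(A i j)`_k| <= M.
Proof.
exists (1 + \sum_i \sum_j \sum_(k < size (A i j)) `|(A i j)`_k|).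
  rewrite ltr_pwDl ?ltr01 //; apply: sumr_ge0 => i _; apply: sumr_ge0 => j _.
  exact: sumr_ge0.
have S0 (i : 'I_m) (j : 'I_n) : 0 <= \sum_(k < size (A i j)) `|(A i j)`_k|
  by rewrite sumr_ge0.
move=> i j k; apply: (@le_trans _ _ (1 + \sum_(k < size (A i j)) `|(A i j)`_k|)).
  have [kd|kd] := ltnP k (size (A i j)).
    by rewrite (bigD1 (Ordinal kd)) //= addrCA lerDl addr_ge0 ?ler01 ?sumr_ge0.
  by rewrite nth_default // normr0 addr_ge0 ?ler01.
rewrite lerD2l (bigD1 i) //= (bigD1 j) //= -addrA lerDl; apply: addr_ge0.
  by apply: sumr_ge0 => j' _; apply: S0.
by apply: sumr_ge0 => i' _; apply: sumr_ge0 => j' _; apply: S0.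
Qed.

(** The points e / (k + 2) for k below [size p] are distinct, lie strictly between 0 and [e], and
    outnumber the roots of [p]. *)
Lemma small_nonroot (p : {poly C}) (e : C) : p != 0 -> 0 < e ->
  exists t : C, [/\ 0 < t, t < e & p.[t] != 0].
Proof.
move=> p0 e0; pose s := [seq e / k.+2%:R | k <- iota 0 (size p)].
have us : uniq s.
  rewrite map_inj_uniq ?iota_uniq // => i j /(mulfI (lt0r_neq0 e0))/invr_inj/eqP.
  by rewrite eqr_nat => /eqP [].
have : ~~ all (root p) s.
  by apply/negP=> /(max_poly_roots p0)/(_ us); rewrite size_map size_iota ltnn.
case/allPn=> _ /mapP[k _ ->] nr; exists (e / k.+2%:R); split=> //.
  by rewrite divr_gt0 ?ltr0n.
by rewrite ltr_pdivrMr ?ltr0n // ltr_pMr // ltr1n.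
Qed.

(** The polynomial [p] records finitely many parameters at which the curve may leave [S]; others
    exist arbitrarily close to 0. *)
Lemma approx_curve m n (S : 'M[{poly C}]_(m, n) -> Prop) P A B (p : {poly C}) :
  p != 0 ->
  (forall t : C, t != 0 -> p.[t] != 0 ->
     S (P + t%:P *: A + (t ^+ 2)%:P *: B)) ->
  approx S P.
Proof.
move=> p0 hS eps e0.
have [MA A0 hA] := coef_bound A; have [MB B0 hB] := coef_bound B.
have M0 : 0 < MA + MB by rewrite addr_gt0.
have D0 : 0 < MA + MB + eps by rewrite addr_gt0.
(* The bound eps / (MA + MB + eps) serves twice: it gives t <= 1, hence t^2 <= t, and it gives t (MA
   + MB) < eps. *)
have [t [t0 te pt]] := small_nonroot p0 (divr_gt0 e0 D0).
have t1 : t <= 1.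
  by apply: le_trans (ltW te) _; rewrite ler_pdivrMr // mul1r lerDr ltW.
exists (P + t%:P *: A + (t ^+ 2)%:P *: B) => [|i j k].
  by apply: hS => //; rewrite lt0r_neq0.
rewrite !mxE !coefD !coefCM opprD addrA opprD addrA subrr sub0r -opprD normrN.
apply: le_lt_trans (ler_normD _ _) _; rewrite (normrM t) (normrM (t ^+ 2)).
have -> : `|t| = t by rewrite gtr0_norm.
have -> : `|t ^+ 2| = t ^+ 2 by rewrite gtr0_norm ?exprn_gt0.
apply: (@le_lt_trans _ _ (t * MA + t * MB)).
  apply: lerD; first by apply: ler_wpM2l (hA _ _ _); apply: ltW.
  apply: ler_pM (hB _ _ _) => //; first by rewrite exprn_ge0 ?ltW.
  by rewrite expr2 ler_piMr // ltW.
rewrite -mulrDr; apply: (@lt_le_trans _ _ (t * (MA + MB + eps))).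
  by rewrite ltr_pM2l // ltrDl.
by rewrite -ler_pdivlMr // ltW.
Qed.

End Approximation.

(** * Products with bounded factor degrees, and balancing of these degrees *)

(** The degree equalities of [Bset] are relaxed to upper bounds, which also admit zero rows and
    columns. *)
Definition prodset (F : fieldType) (m n r d : nat) (e : 'I_r -> nat)
    (P : 'M[{poly F}]_(m, n)) : Prop :=
  exists (L : 'M[{poly F}]_(m, r)) (R : 'M[{poly F}]_(r, n)),
    [/\ forall i j, (size (R i j) <= (e i).+1)%N,
        forall k i, (size (L k i) <= (d - e i).+1)%N & P = L *m R].

Lemma size_mul_le (F : fieldType) (p q : {poly F}) a b :
  (size p <= a.+1)%N -> (size q <= b.+1)%N -> (size (p * q)%R <= (a + b).+1)%N.
Proof. by move=> hp hq; apply: leq_trans (size_polyMleq _ _) _; lia. Qed.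

Lemma prodset_deg_le (m n r d : nat) (e : 'I_r -> nat) (P : 'M[{poly C}]_(m, n)) :
  (forall i, (e i <= d)%N) -> prodset d e P -> deg_le P d.
Proof.
move=> ed [L [R [hR hL ->]]] k j; rewrite mxE.
apply: leq_trans (size_sum _ _ _) _; apply/bigmax_leqP => i _.
by apply: leq_trans (size_mul_le (hL k i) (hR i j)) _; have := ed i; lia.
Qed.

Lemma drop_polyX (F : fieldType) (p : {poly F}) :
  p = 'X * drop_poly 1 p + (p`_0)%:P.
Proof.
rewrite -{1}(poly_take_drop 1 p) expr1 addrC mulrC; congr (_ + _).
by apply/polyP=> k; rewrite coef_take_poly coefC; case: k.
Qed.

Lemma size_le_max (F : fieldType) (p q : {poly F}) k :
  (size p <= k)%N -> (size q <= k)%N -> (size (p + q)%R <= k)%N.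
Proof. by move=> hp hq; apply: leq_trans (size_polyD _ _) _; rewrite geq_max hp. Qed.

Lemma size_scaleC (F : fieldType) (c : F) (p : {poly F}) k :
  (size p <= k)%N -> (size (c%:P * p)%R <= k)%N.
Proof. by move=> hp; rewrite mul_polyC; apply: leq_trans (size_scale_leq _ _) hp. Qed.

Lemma size_mulX_le (F : fieldType) (p : {poly F}) k :
  (size p <= k)%N -> (size ('X * p)%R <= k.+1)%N.
Proof.
move=> hp; have [->|p0] := eqVneq p 0; first by rewrite mulr0 size_poly0.
by rewrite mulrC size_mulX.
Qed.

Lemma sum_split2 (T : Type) (x : T) (op : Monoid.com_law x) (r : nat)
    (f : 'I_r -> T) (i j : 'I_r) : j != i ->
  \big[op/x]_c f c = op (f i) (op (f j) (\big[op/x]_(c | (c != i) && (c != j)) f c)).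
Proof. by move=> ji; rewrite (bigD1 i) //= (bigD1 j). Qed.

(* With l1 r1 + l2 r2 the two terms of the product, r1 = X p + c and
   l2 = X q + e, one has
   (X l1 + t e)(p + r2 / t) + (q - l1 / t)(X r2 - t c)
     = l1 r1 + l2 r2 + t (e p - q c). *)
Lemma prodset_transfer (m n r d : nat) (e : 'I_r -> nat) (i j : 'I_r)
    (P : 'M[{poly C}]_(m, n)) :
  (e j < e i)%N -> (e i <= d)%N -> prodset d e P ->
  approx (prodset d (fun c => if c == i then (e i).-1
                              else if c == j then (e j).+1 else e c)) P.
Proof.
move=> eji eid [L [R [hR hL PE]]].
have ji : j != i by apply: contraTneq eji => ->; rewrite ltnn.
pose A := \matrix_(k < m, l < n) (((L k j)`_0)%:P * drop_poly 1 (R i l)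
   - drop_poly 1 (L k j) * ((R i l)`_0)%:P).
apply: (@approx_curve _ _ _ _ A 0 1 (oner_neq0 _)) => t t0 _.
pose L' := \matrix_(k < m, c < r)
  (if c == i then 'X * L k i + t%:P * ((L k j)`_0)%:P
   else if c == j then drop_poly 1 (L k j) - (t^-1)%:P * L k i else L k c).
pose R' := \matrix_(c < r, l < n)
  (if c == i then drop_poly 1 (R i l) + (t^-1)%:P * R j l
   else if c == j then 'X * R j l - t%:P * ((R i l)`_0)%:P else R c l).
exists L', R'; split=> [c l|k c|].
- rewrite mxE; case: eqP => [_|_].
    apply: size_le_max; first by rewrite size_drop_poly; have := hR i l; lia.
    by apply: size_scaleC; have := hR j l; lia.
  case: eqP => [_|_]; last exact: hR.
  apply: size_le_max; first exact: size_mulX_le.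
  by rewrite size_polyN; apply: size_scaleC; apply: leq_trans (size_polyC_leq1 _) _.
- rewrite mxE; case: eqP => [_|_].
    apply: size_le_max; first by apply: size_mulX_le; have := hL k i; lia.
    by apply: size_scaleC; apply: leq_trans (size_polyC_leq1 _) _.
  case: eqP => [_|_]; last exact: hL.
  apply: size_le_max; first by rewrite size_drop_poly; have := hL k j; lia.
  by rewrite size_polyN; apply: size_scaleC; have := hL k i; lia.
apply/matrixP=> k l; rewrite PE scaler0 addr0 !mxE.
rewrite (sum_split2 _ _ ji) [in RHS](sum_split2 _ _ ji) /=.
rewrite !mxE eqxx (negbTE ji) eqxx.
rewrite [in RHS](eq_bigr (fun c => L k c * R c l)); last first.
  by move=> c /andP[/negbTE ci /negbTE cj]; rewrite !mxE ci cj.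
have tt : t%:P * (t^-1)%:P = 1 :> {poly C} by rewrite -polyCM mulfV.
have := drop_polyX (L k j); have := drop_polyX (R i l).
move: (drop_poly 1 (L k j)) (drop_poly 1 (R i l)) => q p.
move: ((L k j)`_0)%:P ((R i l)`_0)%:P => a b -> ->.
move: (L k i) (R j l) tt => l1 r2.
move: t%:P (t^-1)%:P (\sum_(c | _) _) => u v S uv.
have -> : ('X * l1 + u * a) * (p + v * r2) + ((q - v * l1) * ('X * r2 - u * b) + S)
  = 'X * l1 * p + 'X * q * r2 + (u * v) * a * r2 + (u * v) * l1 * b + u * (a * p - q * b) + S.
  by ring.
by rewrite uv; ring.
Qed.

(** Induction on the total excess of [e] over [b]. An index with e_i > b_i forces one with e_j <
    b_j, as the sums agree; then e_j < e_i because values of [b] differ by at most one, and a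
    transfer from i to j lowers the excess by one. Without excess, e = b. *)
Lemma prodset_balance (m n r d : nat) (e b : 'I_r -> nat) (P : 'M[{poly C}]_(m, n)) :
  (forall i, (e i <= d)%N) -> (forall i j, (b i <= (b j).+1)%N) ->
  \sum_i e i = \sum_i b i -> prodset d e P -> approx (prodset d b) P.
Proof.
move=> + bb; move: {2}(\sum_i (e i - b i))%N (leqnn (\sum_i (e i - b i))%N) => N.
elim: N e P => [|N IH] e P hN ed eb hP; last first.
  have [/existsP[i bi]|] := boolP [exists i, (b i < e i)%N]; last first.
    move/existsPn=> eb'; apply: (IH e) => //.
    by rewrite big1 // => i _; apply/eqP; rewrite subn_eq0 leqNgt.
  have /existsP[j ej] : [exists j, (e j < b j)%N].
    apply/contraT => /existsPn be.
    suff : (\sum_i b i < \sum_i e i)%N by rewrite eb ltnn.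
    rewrite (bigD1 i) //= [X in (_ < X)%N](bigD1 i) //= -addSn leq_add //.
    by apply: leq_sum => c _; rewrite leqNgt.
  have eji : (e j < e i)%N by have := bb j i; lia.
  have ji : j != i by apply: contraTneq eji => ->; rewrite ltnn.
  apply: approx_trans (prodset_transfer eji (ed i) hP) _ => Q; apply: IH.
  - move: hN; rewrite (sum_split2 _ _ ji) [in X in _ -> X](sum_split2 _ _ ji) /=.
    rewrite eqxx (negbTE ji) eqxx.
    rewrite [in X in _ -> X](eq_bigr (fun c => e c - b c)%N); first lia.
    by move=> c /andP[/negbTE -> /negbTE ->].
  - by move=> c; have := ed c; have := ed i; case: eqP => [_|_]; [|case: eqP => _]; lia.
  rewrite -eb (sum_split2 _ _ ji) [in RHS](sum_split2 _ _ ji) /=.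
  rewrite eqxx (negbTE ji) eqxx [in LHS](eq_bigr e); first lia.
  by move=> c /andP[/negbTE -> /negbTE ->].
apply: approx_id; suff E : e =1 b.
  by case: hP => L [R [hR hL PE]]; exists L, R; split=> // [i j|k i]; rewrite -E.
have le i : (e i <= b i)%N.
  by move: hN; rewrite leqn0 sum_nat_eq0 => /forallP/(_ i); rewrite subn_eq0.
move=> i; apply/eqP; rewrite eqn_leq le leqNgt; apply/negP=> bi.
suff : (\sum_i e i < \sum_i b i)%N by rewrite eb ltnn.
rewrite (bigD1 i) //= [X in (_ < X)%N](bigD1 i) //= -addSn leq_add //.
by apply: leq_sum => c _.
Qed.

(** * Clearing denominators and polynomial bases of larger row spaces *)

Section Fractions.

Local Open Scope quotient_scope.

Lemma fraction_numden (R : idomainType) (x : {fraction R}) :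
  exists n d : R, d != 0 /\ x * tofrac d = tofrac n.
Proof.
elim/quotW: x => y; exists \n_y, \d_y; split; first exact: denom_ratioP.
unlock FracField.tofrac; rewrite -[LHS]/(FracField.mul _ _) !piE.
apply/eqP; rewrite piE /= FracField.equivfE /FracField.mulf /=.
rewrite !numden_Ratio ?oner_eq0 ?mulr1 ?mulf_neq0 ?denom_ratioP //.
by rewrite mulrC.
Qed.

End Fractions.

Local Notation "A ^f" := (map_mx (@tofrac _) A) : ring_scope.

Lemma tofrac_mx_inj (R : idomainType) p q : injective (fun A : 'M[R]_(p, q) => A^f).
Proof.
move=> A B /matrixP h; apply/matrixP=> i j; apply/eqP.
by rewrite -tofrac_eq; have := h i j; rewrite !mxE => ->.
Qed.

Lemma clear_denominators (R : idomainType) p q (A : 'M[{fraction R}]_(p, q)) :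
  exists (c : R) (B : 'M[R]_(p, q)), c != 0 /\ B^f = tofrac c *: A.
Proof.
pose U := (R * R)%type.
have [u u1 u2] : exists2 u : forall ij : 'I_p * 'I_q, U,
  (forall ij, (u ij).1 != 0) & (forall ij, A ij.1 ij.2 * tofrac (u ij).1 = tofrac (u ij).2).
  apply: (@fin_all_exists2 _ (fun=> U) (fun _ u => u.1 != 0)
    (fun ij u => A ij.1 ij.2 * tofrac u.1 = tofrac u.2)) => ij.
  by have [n [d [d0 E]]] := fraction_numden (A ij.1 ij.2); exists (d, n).
exists (\prod_ij (u ij).1).
exists (\matrix_(i, j) ((u (i, j)).2 * \prod_(ij | ij != (i, j)) (u ij).1)); split.
  by apply/prodf_neq0.
apply/matrixP=> i j; rewrite !mxE tofracM -(u2 (i, j)) /= [in RHS](bigD1 (i, j)) //= tofracM.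
by rewrite -mulrA mulrC.
Qed.

(** The first [\rank A] rows of [row_ebase A] span the row space of [A]; taking the first [r] rows
    extends them to an independent family. *)
Lemma row_free_superspace (K : fieldType) m n r (A : 'M[K]_(m, n)) :
  (\rank A <= r)%N -> (r <= n)%N -> exists2 U : 'M[K]_(r, n), row_free U & (A <= U)%MS.
Proof.
move=> rA rn; exists (pid_mx r *m row_ebase A).
  apply/row_freeP; exists (invmx (row_ebase A) *m pid_mx r).
  rewrite mulmxA mulmxK ?row_ebase_unit // mul_pid_mx.
  by rewrite minnn (minn_idPr rn) pid_mx_1.
apply/submxP; exists (col_ebase A *m pid_mx (\rank A)).
rewrite mulmxA -[_ *m pid_mx _ *m pid_mx r]mulmxA mul_pid_mx (minn_idPl rA) (minn_idPr rA).
by rewrite mulmx_ebase.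
Qed.

Lemma poly_row_free_superspace (F : fieldType) m n r (P : 'M[{poly F}]_(m, n)) :
  (\rank P^f <= r)%N -> (r <= n)%N ->
  exists2 R : 'M[{poly F}]_(r, n), row_free R^f & (P^f <= R^f)%MS.
Proof.
move=> rP rn; have [U fU PU] := row_free_superspace rP rn.
have [c [R [c0 E]]] := clear_denominators U; exists R.
  by rewrite /row_free E eqmx_scale ?tofrac_eq0.
by rewrite E eqmx_scale ?tofrac_eq0.
Qed.

(** [P] need not be decidable, so the descent on the value of [f] uses excluded middle. *)
Lemma arg_min_exists (T : Type) (P : T -> Prop) (f : T -> nat) :
  (exists x, P x) -> exists x, P x /\ forall y, P y -> (f x <= f y)%N.
Proof.
case=> x; move: {2}(f x) (leqnn (f x)) => N; elim: N x => [|N IH] x fx Px.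
  by exists x; split=> // y _; move: fx; rewrite leqn0 => /eqP ->.
have [[y [Py fy]]|h] := Classical_Prop.classic (exists y, P y /\ (f y < f x)%N).
  by apply: (IH y) => //; rewrite -ltnS (leq_trans fy).
exists x; split=> // y Py; rewrite leqNgt; apply/negP=> fy; apply: h.
by exists y.
Qed.

(** * Factorization through a polynomial basis of minimal row degrees *)

Definition rsize (F : fieldType) (r n : nat) (R : 'M[{poly F}]_(r, n)) (i : 'I_r) : nat :=
  \max_j size (R i j).

Lemma rsizeP (F : fieldType) (r n : nat) (R : 'M[{poly F}]_(r, n)) i k :
  reflect (forall j, (size (R i j) <= k)%N) (rsize R i <= k)%N.
Proof.
by apply: (iffP (bigmax_leqP _ _ _)) => [h j|h j _]; apply: h.
Qed.

Lemma size_rsize (F : fieldType) (r n : nat) (R : 'M[{poly F}]_(r, n)) i j :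
  (size (R i j) <= rsize R i)%N.
Proof. by move: j; apply/rsizeP. Qed.

Lemma rsize_gt0 (F : fieldType) (r n : nat) (R : 'M[{poly F}]_(r, n)) i :
  row_free R^f -> (0 < rsize R i)%N.
Proof.
move=> fR; rewrite lt0n; apply/negP=> /eqP R0.
have E : row i R^f = 0.
  apply/rowP=> j; rewrite !mxE; have := size_rsize R i j.
  by rewrite R0 leqn0 size_poly_eq0 => /eqP ->; rewrite tofrac0.
have /(row_free_inj fR)/matrixP/(_ 0 i)/eqP :
  delta_mx 0 i *m R^f = (0 : 'rV_r) *m R^f by rewrite -rowE mul0mx.
by rewrite !mxE !eqxx oner_eq0.
Qed.

Definition replace_row (F : fieldType) (n r : nat) (R : 'M[{poly F}]_(r, n))
    (k : 'I_r) (w : 'rV[{poly F}]_n) : 'M[{poly F}]_(r, n) :=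
  \matrix_(i, j) (if i == k then w 0 j else R i j).

(** Only row [k] has to be recovered: the relation is solved for it over the field of fractions,
    dividing by u_k. *)
Lemma replace_row_span (F : fieldType) (n r : nat) (R : 'M[{poly F}]_(r, n))
    (k : 'I_r) (w : 'rV[{poly F}]_n) c (u : 'rV[{poly F}]_r) :
  c *: w = u *m R -> u 0 k != 0 -> (R^f <= (replace_row R k w)^f)%MS.
Proof.
move=> E uk; have other i : i != k -> (row i R^f <= (replace_row R k w)^f)%MS.
  move=> ik; have -> : row i R^f = row i (replace_row R k w)^f.
    by apply/rowP=> j; rewrite !mxE (negbTE ik).
  exact: row_sub.
apply/row_subP => i; have [->{i}|] := eqVneq i k; last exact: other.
have uk' : tofrac (u 0 k) != 0 by rewrite tofrac_eq0.
rewrite -(eqmx_scale _ uk').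
have -> : tofrac (u 0 k) *: row k R^f =
   tofrac c *: row k (replace_row R k w)^f - \sum_(i | i != k) tofrac (u 0 i) *: row i R^f.
  apply/rowP=> j; have : tofrac c * tofrac (w 0 j) = \sum_i tofrac (u 0 i) * tofrac (R i j).
    have /rowP/(_ j)/(congr1 (@tofrac _)) := E; rewrite !mxE tofracM => ->.
    by rewrite rmorph_sum; apply: eq_bigr => i _; rewrite rmorphM.
  rewrite !mxE eqxx (bigD1 k) //= => ->; rewrite summxE.
  rewrite [X in _ - X](eq_bigr (fun i => tofrac (u 0 i) * tofrac (R i j))) ?addrK //.
  by move=> i _; rewrite !mxE.
apply: addmx_sub; first exact/scalemx_sub/row_sub.
by rewrite (eqmx_opp _); apply: summx_sub => i ik; apply/scalemx_sub/other.
Qed.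

(** Exchange argument: after the replacement the rows are still independent and still span the rows
    of [P], and only the term of row [k] in the minimized sum has changed. *)
Lemma min_replace (F : fieldType) (m n r : nat) (P : 'M[{poly F}]_(m, n))
    (R : 'M[{poly F}]_(r, n)) (k : 'I_r) (w : 'rV[{poly F}]_n) c (u : 'rV[{poly F}]_r) :
  row_free R^f -> (P^f <= R^f)%MS ->
  (forall R' : 'M[{poly F}]_(r, n), row_free R'^f -> (P^f <= R'^f)%MS ->
     (\sum_i rsize R i <= \sum_i rsize R' i)%N) ->
  c *: w = u *m R -> u 0 k != 0 -> (rsize R k <= rsize w ord0)%N.
Proof.
move=> fR PR minR E uk; have RR := replace_row_span E uk.
set R' := replace_row R k w in RR.
have fR' : row_free R'^f.
  by rewrite /row_free eqn_leq rank_leq_row -{1}(eqP fR) mxrankS.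
have := minR R' fR' (submx_trans PR RR).
rewrite (bigD1 k) //= [X in (_ <= X)%N](bigD1 k) //=.
rewrite (_ : rsize R' k = rsize w ord0); last first.
  by apply: eq_bigr => j _; rewrite !mxE eqxx.
rewrite (_ : \sum_(i | i != k) rsize R' i = \sum_(i | i != k) rsize R i)%N ?leq_add2r //.
apply: eq_bigr => i /negbTE ik.
by apply: eq_bigr => j _; rewrite !mxE ik.
Qed.

Lemma size_XsubC_mul (F : fieldType) (x : F) (p : {poly F}) :
  p != 0 -> size (('X - x%:P) * p) = (size p).+1.
Proof.
move=> p0; rewrite size_monicM ?monicXsubC ?size_XsubC //.
Qed.

Lemma scalemx_inj (R : idomainType) m n (c : R) : c != 0 ->
  injective (fun A : 'M[R]_(m, n) => c *: A).
Proof.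
move=> c0 A B /matrixP E; apply/matrixP=> i j; apply: (mulfI c0).
by have := E i j; rewrite !mxE.
Qed.

(** A combination with constant coefficients does not raise the degree, and dividing it by X - x
    lowers the degree by one. *)
Lemma rsize_mul_lt (F : fieldType) (r n : nat) (R : 'M[{poly F}]_(r, n))
    (w : 'rV[{poly F}]_n) (x : F) (N : nat) (u : 'rV[{poly F}]_r) :
  (0 < N)%N -> (forall i, u 0 i != 0 -> (rsize R i <= N)%N) ->
  (forall i, (size (u ord0 i) <= 1)%N) ->
  ('X - x%:P) *: w = u *m R -> (rsize w ord0 < N)%N.
Proof.
move=> N0 hu u1 E; rewrite -(prednK N0) ltnS; apply/rsizeP => j.
have [->|w0] := eqVneq (w ord0 j) 0; first by rewrite size_poly0.
rewrite -ltnS (prednK N0) -(size_XsubC_mul x) //.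
have /matrixP/(_ 0 j) := E; rewrite !mxE => ->.
apply: leq_trans (size_sum _ _ _) _; apply/bigmax_leqP => i _.
have [->|ui] := eqVneq (u 0 i) 0; first by rewrite mul0r size_poly0.
apply: leq_trans (leq_trans (size_rsize R i j) (hu i ui)).
by rewrite (size1_polyC (u1 i)); apply: size_scaleC.
Qed.

(* A root x of the common denominator of L would give a constant combination of
   the rows of R divisible by X - x, which could replace a row of R. *)
Lemma min_factor (F : closedFieldType) (m n r : nat) (P : 'M[{poly F}]_(m, n))
    (R : 'M[{poly F}]_(r, n)) :
  row_free R^f -> (P^f <= R^f)%MS ->
  (forall R' : 'M[{poly F}]_(r, n), row_free R'^f -> (P^f <= R'^f)%MS ->
     (\sum_i rsize R i <= \sum_i rsize R' i)%N) ->
  exists L, P = L *m R.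
Proof.
move=> fR PR minR.
pose good (qL : {poly F} * 'M[{poly F}]_(m, r)) := qL.1 != 0 /\ qL.1 *: P = qL.2 *m R.
have [[q L] [[/= q0 qE] qmin]] : exists x, good x /\ forall y, good y -> (size x.1 <= size y.1)%N.
  apply: arg_min_exists; have /submxP[D PE] := PR.
  have [c [L [c0 LE]]] := clear_denominators D; exists (c, L); split=> //=.
  by apply: tofrac_mx_inj; rewrite map_mxM /= map_mxZ /= LE PE scalemxAl.
have [/eqP/eqP sq|] := boolP (size q == 1%N).
  have [c c0 qc] : exists2 c, c != 0 & q = c%:P.
    by apply/size_poly1P; rewrite sq.
  exists (c^-1%:P *: L); rewrite -scalemxAl -qE scalerA qc -polyCM mulVf //.
  by rewrite scale1r.
move=> /closed_rootP[x qx]; exfalso.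
have [/existsP[k /existsP[i Lki]]|] := boolP [exists k, [exists i, ~~ root (L k i) x]]; last first.
  (* If every entry of [L] vanished at x, both [q] and [L] could be divided by X - x, against the
     minimality of [q]. *)
  move=> /existsPn h; have Lx k i : root (L k i) x.
    by have /existsPn/(_ i) := h k; rewrite negbK.
  have := qx; rewrite -dvdp_XsubCl => /divpK q1.
  have q1n0 : q %/ ('X - x%:P) != 0 by apply: contraNneq q0 => E; rewrite -q1 E mul0r.
  have gq : good (q %/ ('X - x%:P), map_mx (fun p => p %/ ('X - x%:P)) L).
    split=> //=; apply: (@scalemx_inj _ _ _ ('X - x%:P)); first by rewrite polyXsubC_eq0.
    rewrite scalerA mulrC q1 qE scalemxAl; congr (_ *m _); apply/matrixP=> k i.
    by rewrite !mxE mulrC divpK ?dvdp_XsubCl.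
  have /= := qmin _ gq; rewrite leqNgt => /negP; apply.
  by rewrite -{2}q1 mulrC size_XsubC_mul.
pose u : 'rV[{poly F}]_r := \row_i ((L k i).[x])%:P.
pose w : 'rV[{poly F}]_n := \row_j ((u *m R) 0 j %/ ('X - x%:P)).
have wE : ('X - x%:P) *: w = u *m R.
  apply/rowP=> j; rewrite [LHS]mxE [w 0 j]mxE mulrC divpK // dvdp_XsubCl.
  have /matrixP/(_ k j)/(congr1 (fun p => p.[x])) := qE.
  rewrite !mxE hornerM (rootP qx) mul0r /root => /esym/eqP.
  rewrite !horner_sum; congr (_ == 0); apply: eq_bigr => i' _.
  by rewrite !mxE !hornerM hornerC.
have ui : u 0 i != 0 by rewrite mxE polyC_eq0.
(* The row to be replaced is the largest one with a nonzero coefficient, since [w] is smaller than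
   that row. *)
case: (arg_maxnP (rsize R) (ui : (fun i => u 0 i != 0) i)) => i0 ui0 maxi.
have := min_replace fR PR minR wE ui0; apply/negP; rewrite -ltnNge.
apply: (rsize_mul_lt (rsize_gt0 _ fR) maxi _ wE) => i1.
by rewrite mxE size_polyC_leq1.
Qed.

Lemma coef_mul_top (F : fieldType) (p q : {poly F}) a b :
  (size p <= a.+1)%N -> (size q <= b.+1)%N -> (p * q)`_(a + b) = p`_a * q`_b.
Proof.
move=> pa qb; have ab : (a < (a + b).+1)%N by lia.
rewrite coefM (bigD1 (Ordinal ab)) //= addKn big1 ?addr0 // => j ja.
have [h|h] := ltnP j a.
  by rewrite [q`_ _]nth_default ?mulr0 //; apply: leq_trans qb _; rewrite leq_subRL; lia.
rewrite [p`_j]nth_default ?mul0r //; apply: leq_trans pa _.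
by rewrite ltn_neqAle h andbT eq_sym.
Qed.

(* If some deg L_ki + deg R_i* exceeded d, the leading coefficients of the L_ki
   with maximal deg L_ki + deg R_i* would give a combination of the rows of R of
   smaller degree, which could replace a row of R. *)
Lemma min_degrees (F : closedFieldType) (m n r d : nat) (P : 'M[{poly F}]_(m, n))
    (L : 'M[{poly F}]_(m, r)) (R : 'M[{poly F}]_(r, n)) :
  row_free R^f -> (forall i j, (size (P i j) <= d.+1)%N) -> P = L *m R ->
  (forall R' : 'M[{poly F}]_(r, n), row_free R'^f -> (P^f <= R'^f)%MS ->
     (\sum_i rsize R i <= \sum_i rsize R' i)%N) ->
  forall k i, L k i != 0 -> (size (L k i) + rsize R i <= d.+2)%N.
Proof.
move=> fR dP PE minR k i Lki; rewrite leqNgt; apply/negP=> big.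
pose f c := (size (L k c) + rsize R c)%N.
case: (arg_maxnP f (Lki : (fun c => L k c != 0) i)) => i1 Li1 max1.
set M := f i1 in max1; have Mbig : (d.+2 < M)%N by apply: leq_trans big (max1 i Lki).
pose I c := (L k c != 0) && (f c == M).
have I1 : I i1 by rewrite /I Li1 /=.
case: (arg_maxnP (rsize R) I1) => i2 I2 max2; set E := rsize R i2 in max2.
have E0 : (0 < E)%N by apply: rsize_gt0.
(* The powers of X bring all selected rows to the common size [E], so that their leading terms can
   cancel. *)
pose u : 'rV[{poly F}]_r :=
  \row_c (if I c then (lead_coef (L k c))%:P * 'X^(E - rsize R c) else 0).
have PR : (P^f <= R^f)%MS by rewrite PE map_mxM submxMl.
have u2 : u 0 i2 != 0.
  case/andP: (I2) => L2 _.
  by rewrite mxE I2 mulf_neq0 ?polyC_eq0 ?lead_coef_eq0 ?expf_neq0 ?polyX_eq0.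
have := min_replace fR PR minR (scale1r (u *m R)) u2; apply/negP; rewrite -ltnNge.
rewrite -/E -(prednK E0) ltnS; apply/rsizeP => j.
have uRsz c : (size (u ord0 c * R c j)%R <= E.-1.+1)%N.
  rewrite mxE prednK //; case: ifP => Ic; last by rewrite mul0r size_poly0.
  have [->|R0] := eqVneq (R c j) 0; first by rewrite mulr0 size_poly0.
  rewrite -mulrA; apply: size_scaleC; rewrite mulrC size_mulXn //.
  have cE : (rsize R c <= E)%N := max2 c Ic.
  by rewrite -[X in (_ <= X)%N](subnK cE) leq_add2l size_rsize.
have top : ((u *m R) ord0 j)`_E.-1 = 0.
  rewrite mxE coef_sum.
  have := dP k j; rewrite PE mxE => hP.
  (* A size is one more than a degree, so [M - 2] is the largest degree possible in a term; it
     exceeds d, hence this coefficient of [P] is zero. *)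
  have : (\sum_c L k c * R c j)`_(M - 2) = 0 by apply: nth_default; apply: leq_trans hP _; lia.
  rewrite coef_sum => S0; rewrite -[RHS]S0; apply: eq_bigr => c _.
  have Rc0 := rsize_gt0 c fR; have Rs := size_rsize R c j.
  rewrite mxE; case: ifP => [Ic|].
    have cE : (rsize R c <= E)%N := max2 c Ic; have /andP[Lc /eqP fc] := Ic.
    have sL : (0 < size (L k c))%N by rewrite size_poly_gt0.
    rewrite -mulrA coefCM coefXnM ifF; last by lia.
    rewrite (_ : E.-1 - (E - rsize R c) = (rsize R c).-1)%N; last by lia.
    rewrite (_ : M - 2 = (size (L k c)).-1 + (rsize R c).-1)%N; last by rewrite -fc /f; lia.
    by rewrite coef_mul_top // prednK.
  move=> nI; rewrite mul0r coef0.
  have [->|Lc] := eqVneq (L k c) 0; first by rewrite mul0r coef0.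
  have sL : (0 < size (L k c))%N by rewrite size_poly_gt0.
  have fM : (f c < M)%N.
    have cM : (f c <= M)%N := max1 c Lc.
    by rewrite ltn_neqAle cM andbT; move: nI; rewrite /I Lc /= => ->.
  apply/esym/nth_default; apply: leq_trans (size_polyMleq _ _) _.
  apply: (@leq_trans (f c).-1); first by rewrite -!subn1 leq_sub2r // leq_add2l.
  by move: fM; lia.
have sz : (size ((u *m R) ord0 j) <= E.-1.+1)%N.
  rewrite mxE; apply: leq_trans (size_sum _ _ _) _; apply/bigmax_leqP => c _.
  exact: uRsz.
apply/leq_sizeP => l; rewrite leq_eqVlt => /predU1P[<- //|lE].
by apply: nth_default; apply: leq_trans sz lE.
Qed.

Lemma factor_exists (m n r d : nat) (P : 'M[{poly C}]_(m, n)) :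
  deg_le P d -> (normal_rank P <= r)%N -> (r <= n)%N ->
  exists2 e : 'I_r -> nat, (forall i, (e i <= d)%N) & prodset d e P.
Proof.
move=> dP rP rn; have [R0 fR0 PR0] := poly_row_free_superspace rP rn.
have [R [[fR PR] minR]] : exists R : 'M[{poly C}]_(r, n),
    (row_free R^f /\ (P^f <= R^f)%MS) /\
    forall R' : 'M[{poly C}]_(r, n), row_free R'^f /\ (P^f <= R'^f)%MS ->
      (\sum_i rsize R i <= \sum_i rsize R' i)%N.
  by apply: arg_min_exists; exists R0.
have {}minR (R' : 'M[{poly C}]_(r, n)) : row_free R'^f -> (P^f <= R'^f)%MS ->
  (\sum_i rsize R i <= \sum_i rsize R' i)%N by move=> *; apply: minR.
have [L PE] := min_factor fR PR minR; have dLR := min_degrees fR dP PE minR.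
(* Where column i of [L] vanishes, [min_degrees] gives no bound on row i of [R]. That row is
   replaced by zero, with e_i = 0, and the product is unchanged. *)
pose Z i := [forall k, L k i == 0].
have nZ i : ~~ Z i -> exists2 k, L k i != 0 & (rsize R i <= d.+1)%N.
  move=> /forallPn[k Lki]; exists k => //.
  by rewrite -ltnS; apply: leq_trans (dLR k i Lki); rewrite -add1n leq_add2r size_poly_gt0.
exists (fun i => if Z i then 0 else (rsize R i).-1)%N.
  by move=> i; case: ifPn => // /nZ[k _]; lia.
exists L, (\matrix_(i, j) (if Z i then 0 else R i j)); split.
- move=> i j; rewrite mxE; case: ifP => _; first by rewrite size_poly0.
  by rewrite prednK ?rsize_gt0 // size_rsize.
- move=> k i; case: ifPn => [/forallP/(_ k)/eqP->|/nZ[_ _ hi]]; first by rewrite size_poly0.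
  have [->|Lki] := eqVneq (L k i) 0; first by rewrite size_poly0.
  have arith (a b : nat) : (a + b <= d.+2)%N -> (0 < b)%N -> (a <= (d - b.-1).+1)%N by lia.
  exact: arith (dLR k i Lki) (rsize_gt0 i fR).
apply/matrixP=> k j; rewrite PE !mxE; apply: eq_bigr => i _; rewrite mxE.
by case: ifP => // /forallP/(_ k)/eqP->; rewrite !mul0r.
Qed.

(** * Multiplication by a polynomial matrix as a constant matrix *)

Section Sylvester.

Variable F : fieldType.

Definition decode (n K : nat) (u : 'rV[F]_(n * K)) : 'cV[{poly F}]_n :=
  \col_j rVpoly (row j (vec_mx u)).

Definition encode (n K : nat) (x : 'cV[{poly F}]_n) : 'rV[F]_(n * K) :=
  mxvec (\matrix_(j, k) (x j 0)`_k).

(** The bound is on sizes: entry j has degree strictly less than [K j]. *)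
Definition size_col (n : nat) (x : 'cV[{poly F}]_n) (K : 'I_n -> nat) : Prop :=
  forall j, (size (x j ord0) <= K j)%N.

Lemma size_decode n K (u : 'rV[F]_(n * K)) : size_col (decode u) (fun=> K).
Proof. by move=> j; rewrite mxE size_poly. Qed.

Lemma encodeK n K (x : 'cV[{poly F}]_n) :
  size_col x (fun=> K) -> decode (encode K x) = x.
Proof.
move=> xK; apply/colP=> j; rewrite !mxE mxvecK -[RHS](poly_rV_K (xK j)).
by congr rVpoly; apply/rowP=> k; rewrite !mxE.
Qed.

Lemma decodeK n K : cancel (@decode n K) (encode K).
Proof.
move=> u; rewrite /encode -[RHS]vec_mxK; congr mxvec; apply/matrixP=> j k.
by rewrite !mxE coef_rVpoly_ord !mxE.
Qed.

Lemma decode_linear n K a (u v : 'rV[F]_(n * K)) :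
  decode (a *: u + v) = a%:P *: decode u + decode v.
Proof.
by apply/colP=> j; rewrite !mxE !linearD !linearZ /= mul_polyC.
Qed.

(** Unlike [encode], this allows a different block length for each entry, because the rows of [R]
    have different degrees. *)
Definition encode_rows (r : nat) (e : 'I_r -> nat) (c : 'cV[{poly F}]_r) :
    'rV[F]_(\sum_i e i) :=
  \mxrow_i (poly_rV (c i ord0) : 'rV_(e i)).

Definition decode_rows (r : nat) (e : 'I_r -> nat) (v : 'rV[F]_(\sum_i e i)) :
    'cV[{poly F}]_r := \col_i rVpoly (submxrow v i).

Lemma encode_rowsK r (e : 'I_r -> nat) (c : 'cV[{poly F}]_r) :
  size_col c e -> decode_rows (encode_rows e c) = c.
Proof.
by move=> ce; apply/colP=> i; rewrite mxE mxrowK poly_rV_K.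
Qed.

Lemma decode_rowsK r (e : 'I_r -> nat) (v : 'rV[F]_(\sum_i e i)) :
  encode_rows e (decode_rows v) = v.
Proof.
rewrite -[RHS]submxrowK; apply: eq_mxrow => i.
by rewrite mxE rVpolyK.
Qed.

Lemma size_decode_rows r (e : 'I_r -> nat) (v : 'rV[F]_(\sum_i e i)) :
  size_col (decode_rows v) e.
Proof. by move=> i; rewrite mxE size_poly. Qed.

Lemma encode_rows_linear r (e : 'I_r -> nat) a (c c' : 'cV[{poly F}]_r) :
  encode_rows e (a%:P *: c + c') = a *: encode_rows e c + encode_rows e c'.
Proof.
rewrite -[RHS]submxrowK; apply: eq_mxrow => i.
rewrite submxrowD mxrowK !mxE mul_polyC linearP /=; congr (_ + _).
by rewrite -(mxrowK (fun i => poly_rV (c i ord0) : 'rV_(e i)) i); apply/rowP=> j; rewrite !mxE.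
Qed.

Lemma mul_rV_lin1_fun m n (f : 'rV[F]_m -> 'rV[F]_n) u :
  (forall a u v, f (a *: u + v) = a *: f u + f v) -> u *m lin1_mx f = f u.
Proof.
move=> lf; pose g : {linear 'rV[F]_m -> 'rV[F]_n} :=
  HB.pack f (GRing.isLinear.Build F _ _ _ f (fun a u v => lf a u v)).
exact: (mul_rV_lin1 g).
Qed.

(** A generalized Sylvester matrix: it represents x |-> R x from vectors of degree < K to vectors
    whose i-th entry has degree < e_i + K. *)
Definition syl (r n : nat) (e : 'I_r -> nat) (K : nat) (R : 'M[{poly F}]_(r, n)) :
    'M[F]_(n * K, \sum_i (e i + K)) :=
  lin1_mx (fun u => encode_rows (fun i => (e i + K)%N) (R *m decode u)).

Lemma sylE r n (e : 'I_r -> nat) K (R : 'M[{poly F}]_(r, n)) u :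
  u *m syl e K R = encode_rows (fun i => (e i + K)%N) (R *m decode u).
Proof.
apply: (@mul_rV_lin1_fun _ _ (fun u => encode_rows _ (R *m decode u))) => a u1 u2.
by rewrite decode_linear mulmxDr -scalemxAr encode_rows_linear.
Qed.

(** This turns a line of polynomial matrices into a linear pencil of constant matrices. *)
Lemma syl_linear r n (e : 'I_r -> nat) K a (R R' : 'M[{poly F}]_(r, n)) :
  syl e K (a%:P *: R + R') = a *: syl e K R + syl e K R'.
Proof.
apply/row_matrixP=> i; rewrite rowE linearD /= linearZ /= !rowE !sylE.
by rewrite mulmxDl -scalemxAl encode_rows_linear.
Qed.

Definition row_bounded (r n : nat) (e : 'I_r -> nat) (R : 'M[{poly F}]_(r, n)) : Prop :=
  forall i j, (size (R i j) <= (e i).+1)%N.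

Lemma size_mul_col r n (e : 'I_r -> nat) K (R : 'M[{poly F}]_(r, n)) x :
  row_bounded e R -> size_col x (fun=> K) -> size_col (R *m x) (fun i => (e i + K)%N).
Proof.
move=> eR xK i; rewrite mxE; apply: leq_trans (size_sum _ _ _) _.
apply/bigmax_leqP => j _; have [->|x0] := eqVneq (x j ord0) 0.
  by rewrite mulr0 size_poly0.
have K0 : (0 < K)%N by apply: leq_trans (xK j); rewrite size_poly_gt0.
by rewrite -(prednK K0) addnS; apply: size_mul_le (eR i j) _; rewrite prednK.
Qed.

(** The degree bound on [R] ensures that [encode_rows] truncates nothing. *)
Lemma syl_kernel r n (e : 'I_r -> nat) K (R : 'M[{poly F}]_(r, n)) u :
  row_bounded e R -> (u *m syl e K R == 0) = (R *m decode u == 0).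
Proof.
move=> eR; rewrite sylE; apply/eqP/eqP=> [E|->].
  have /encode_rowsK <- := size_mul_col eR (size_decode u).
  by rewrite E; apply/colP=> i; rewrite !mxE submxrow0 linear0.
by rewrite -[RHS]submxrowK; apply: eq_mxrow => i; rewrite mxE linear0 submxrow0.
Qed.

Definition col_inj (r n K : nat) (R : 'M[{poly F}]_(r, n)) : Prop :=
  forall x : 'cV_n, size_col x (fun=> K) -> R *m x = 0 -> x = 0.

Definition col_surj (r n : nat) (e : 'I_r -> nat) (K : nat) (R : 'M[{poly F}]_(r, n)) : Prop :=
  forall c : 'cV_r, size_col c (fun i => (e i + K)%N) ->
    exists2 x : 'cV_n, size_col x (fun=> K) & R *m x = c.

Lemma decode0 n K : decode (0 : 'rV[F]_(n * K)) = 0.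
Proof. by apply/colP=> j; rewrite !mxE linear0 row0 linear0. Qed.

Lemma row_free_syl r n (e : 'I_r -> nat) K (R : 'M[{poly F}]_(r, n)) :
  row_bounded e R -> row_free (syl e K R) <-> col_inj K R.
Proof.
move=> eR; split=> [fS x xK Rx|inj].
  apply/eqP; rewrite -(encodeK xK); apply/eqP.
  suff -> : encode K x = 0 by rewrite decode0.
  apply: (row_free_inj fS); rewrite mul0mx; apply/eqP.
  by rewrite syl_kernel // encodeK // Rx.
apply: inj_row_free => u /eqP; rewrite syl_kernel // => /eqP Ru.
rewrite -[u]decodeK (inj _ (size_decode u) Ru).
rewrite /encode; apply/eqP; rewrite mxvec_eq0; apply/eqP/matrixP=> j k.
by rewrite !mxE coef0.
Qed.

Lemma row_full_syl r n (e : 'I_r -> nat) K (R : 'M[{poly F}]_(r, n)) :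
  row_bounded e R -> row_full (syl e K R) <-> col_surj e K R.
Proof.
move=> eR; split=> [fS c cK|surj].
  have /submxP[u uE] := submx_full (encode_rows (fun i => (e i + K)%N) c) fS.
  exists (decode u); first exact: size_decode.
  rewrite -(encode_rowsK cK) uE sylE encode_rowsK //.
  exact: size_mul_col (size_decode u).
rewrite -sub1mx; apply/row_subP => i; apply/submxP.
have [x xK E] := surj _ (size_decode_rows (row i 1%:M)).
by exists (encode K x); rewrite sylE encodeK // E decode_rowsK.
Qed.

End Sylvester.

(** * Matrices of top coefficients, and consequences of the two rank conditions *)

Section TopCoefficients.

Variable F : fieldType.

Definition top_coef (r n : nat) (e : 'I_r -> nat) (R : 'M[{poly F}]_(r, n)) : 'M[F]_(r, n) :=
  \matrix_(i, j) (R i j)`_(e i).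

Lemma coef_mul_col_top r n p (e : 'I_r -> nat) K (R : 'M[{poly F}]_(r, n))
    (X : 'M[{poly F}]_(n, p)) i j :
  row_bounded e R -> (forall i j, (size (X i j) <= K.+1)%N) ->
  ((R *m X) i j)`_(e i + K) = (top_coef e R *m \matrix_(i, j) (X i j)`_K) i j.
Proof.
move=> eR XK; rewrite !mxE coef_sum; apply: eq_bigr => l _.
by rewrite !mxE coef_mul_top.
Qed.

Lemma size_prod_top (I : Type) (s : seq I) (p : I -> {poly F}) (k : I -> nat) :
  (forall i, (size (p i) <= (k i).+1)%N) ->
  (size (\prod_(i <- s) p i)%R <= (\sum_(i <- s) k i).+1)%N /\
  (\prod_(i <- s) p i)`_(\sum_(i <- s) k i) = \prod_(i <- s) (p i)`_(k i).
Proof.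
move=> pk; elim: s => [|i s [IH1 IH2]].
  by rewrite !big_nil size_poly1 coef1.
rewrite !big_cons; split; first exact: size_mul_le.
by rewrite coef_mul_top // IH2.
Qed.

Lemma coef_det_top n (A : 'M[{poly F}]_n) (k : 'I_n -> nat) :
  row_bounded k A -> (\det A)`_(\sum_i k i) = \det (top_coef k A).
Proof.
move=> kA; rewrite /determinant coef_sum; apply: eq_bigr => s _.
have [_ h] := @size_prod_top _ (index_enum 'I_n) (fun i => A i (s i)) k (fun i => kA i (s i)).
rewrite -!(rmorph_sign (@polyC F)) coefCM h; congr (_ * _).
by apply: eq_bigr => i _; rewrite mxE.
Qed.

(** With a right inverse [Y] of the top coefficients, [R] times [Y] is square and its determinant
    has coefficient 1 at the sum of the e_i, so it is nonzero. *)
Lemma row_free_top n r (e : 'I_r -> nat) (R : 'M[{poly F}]_(r, n)) :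
  row_bounded e R -> row_free (top_coef e R) -> row_free R^f.
Proof.
move=> eR /row_freeP[Y hY]; pose A := R *m map_mx (@polyC F) Y.
have A0 : \det A != 0.
  have eA : row_bounded e A.
    move=> i j; rewrite mxE; apply: leq_trans (size_sum _ _ _) _.
    apply/bigmax_leqP => l _; rewrite mxE mulrC; exact: size_scaleC.
  apply/eqP=> dA; have := coef_det_top eA; rewrite dA coef0.
  suff -> : top_coef e A = 1%:M by rewrite det1 => /esym/eqP; rewrite oner_eq0.
  rewrite -hY; apply/matrixP=> i j; rewrite mxE -[X in _`_X]addn0.
  rewrite coef_mul_col_top // => [|l l']; last by rewrite mxE size_polyC_leq1.
  rewrite !mxE; apply: eq_bigr => l _; rewrite !mxE coefC eqxx //.
have : row_free A^f.
  by rewrite row_free_unit unitmxE unitfE det_map_mx tofrac_eq0.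
rewrite /row_free map_mxM !eqn_leq !rank_leq_row /= => h.
exact: leq_trans h (mxrankM_maxl _ _).
Qed.

Lemma rowsub_free (K : fieldType) m n p (g : 'I_p -> 'I_m) (A : 'M[K]_(m, n)) :
  injective g -> row_free A -> row_free (rowsub g A).
Proof.
move=> gi fA; rewrite rowsubE /row_free mxrankMfree //.
apply/eqP; have /eqP : row_free (rowsub g 1%:M : 'M[K]_(p, m)); last by [].
apply/row_freeP; exists (rowsub g 1%:M)^T; apply/matrixP=> i j.
rewrite !mxE (bigD1 (g i)) //= !mxE eqxx mul1r big1 ?addr0 ?(inj_eq gi) 1?eq_sym //.
by move=> l /negbTE li; rewrite !mxE eq_sym li mul0r.
Qed.

(** The source of [syl e K R] has dimension n K, the target sum e_i + r K. For n = r + N and al =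
    floor (sum e_i / N), the source is no larger at K = al and no smaller at K = al + 1, so both
    conditions ask for full rank. *)
Definition good (r n : nat) (e : 'I_r -> nat) (al : nat) (R : 'M[{poly F}]_(r, n)) : Prop :=
  [/\ row_bounded e R, col_inj al R & col_surj e al.+1 R].

Section Good.

Variables (r n al : nat) (e : 'I_r -> nat) (R : 'M[{poly F}]_(r, n)).
Hypothesis gR : good e al R.

(** Surjectivity gives preimages of the vectors X^(e_i + al) times a unit vector; their coefficients
    at X^al form a right inverse. *)
Lemma good_top_free : row_free (top_coef e R).
Proof.
have [eR _ sR] := gR.
have hx i : exists2 x : 'cV_n, size_col x (fun=> al.+1)
    & R *m x = 'X^(e i + al) *: delta_mx i 0.
  apply: sR => i'; rewrite !mxE eqxx andbT; case: eqP => [->|_].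
    by rewrite mulr1 size_polyXn addnS.
  by rewrite mulr0 size_poly0.
have [x x1 x2] := fin_all_exists2 hx.
pose X := \matrix_(j, i) x i j ord0.
apply/row_freeP; exists (\matrix_(j, i) (X j i)`_al).
apply/matrixP=> i j; rewrite -coef_mul_col_top // => [|l l']; last by rewrite mxE x1.
have -> : (R *m X) i j = (R *m x j) i ord0.
  by rewrite !mxE; apply: eq_bigr => l _; rewrite mxE.
rewrite x2 !mxE eqxx andbT; case: eqP => [->|_].
  by rewrite mulr1 coefXn eqxx.
by rewrite mulr0 coef0.
Qed.

Lemma good_row_free : row_free R^f.
Proof. by have [eR _ _] := gR; apply: row_free_top eR good_top_free. Qed.

(** Count dimensions among vectors of degree <= al: the kernel of [R] has codimension exactly sum
    e_i + r (al + 1) by surjectivity, while that of [R'] has codimension at most sum f_i + r (al +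
    1) and is contained in it. *)
Lemma good_min (f : 'I_r -> nat) (R' : 'M[{poly F}]_(r, n)) :
  row_bounded f R' -> (forall x : 'cV_n, R' *m x = 0 -> R *m x = 0) ->
  (\sum_i e i <= \sum_i f i)%N.
Proof.
move=> fR' ker; have [eR _ /(row_full_syl _ eR) sR] := gR.
have kk : (kermx (syl f al.+1 R') <= kermx (syl e al.+1 R))%MS.
  apply/rV_subP => u /sub_kermxP/eqP; rewrite syl_kernel // => /eqP/ker E.
  by apply/sub_kermxP/eqP; rewrite syl_kernel // E.
have := mxrankS kk; rewrite !mxrank_ker (eqP sR).
have := rank_leq_col (syl f al.+1 R').
have := rank_leq_row (syl f al.+1 R').
have := rank_leq_row (syl e al.+1 R); rewrite (eqP sR).
have E g : (\sum_(i < r) (g i + al.+1) = \sum_i g i + r * al.+1)%N.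
  by rewrite big_split sum_nat_const card_ord.
move: (E e) (E f); move: (\rank (syl f al.+1 R')) => a.
move: (\sum_i (e i + _))%N (\sum_i (f i + _))%N => b c; lia.
Qed.

End Good.

End TopCoefficients.

(** * The kernel of a good matrix and the degrees of its bases *)

Lemma eqmx_of_rank (K : fieldType) m n k (M : 'M[K]_(m, n)) :
  \rank M = k -> exists A : 'M[K]_(k, n), (A :=: M)%MS.
Proof. by move=> <-; exists (row_base M); apply: eq_row_base. Qed.

Lemma extend_free (K : fieldType) m1 m2 n s q (W : 'M[K]_(m1, n)) (W1 : 'M[K]_(m2, n)) :
  (W1 <= W)%MS -> \rank W1 = q -> \rank W = (s + q)%N ->
  exists H : 'M[K]_(s + q, n),
    [/\ row_free H, (usubmx H <= W)%MS & (dsubmx H <= W1)%MS].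
Proof.
move=> W1W rW1 rW; have [B BE] := eqmx_of_rank rW1.
have rD : \rank (W :\: W1)%MS = s.
  have := mxrank_cap_compl W W1.
  by rewrite (capmx_idPr _) // rW1 rW addnC => /addIn.
have [A AE] := eqmx_of_rank rD; exists (col_mx A B); rewrite col_mxKu col_mxKd; split.
- have := mxrank_sum_cap (W :\: W1)%MS W1; rewrite capmx_diff mxrank0 addn0 rD rW1.
  by rewrite /row_free -addsmxE (adds_eqmx AE BE) => ->.
- by rewrite AE diffmxSl.
by rewrite BE.
Qed.

Section Kernel.

Variables (F : fieldType) (r n N s al : nat) (e : 'I_r -> nat) (R : 'M[{poly F}]_(r, n)).

Hypotheses (gR : good e al R) (nE : n = (r + N)%N) (sN : (s <= N)%N).
Hypothesis se : (\sum_i e i = N * al + s)%N.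

(** [W] holds the possible leading coefficient vectors of kernel vectors, [V] the coefficient
    vectors of kernel vectors of degree <= al, and [T] reads off the coefficient at X^al. *)
Let W := kermx (top_coef e R)^T.
Let V := kermx (syl e al.+1 R).
Let top (u : 'rV[F]_(n * al.+1)) : 'rV[F]_n := \row_j (decode u j 0)`_al.
Let T := lin1_mx top.

Lemma topE u : u *m T = top u.
Proof.
apply: mul_rV_lin1_fun => a u1 u2; apply/rowP=> j.
by rewrite mxE decode_linear !mxE coefD coefCM.
Qed.

Lemma rank_top_kernel : \rank W = N.
Proof. by rewrite mxrank_ker mxrank_tr (eqP (good_top_free gR)) nE addKn. Qed.

Lemma rank_low_kernel : \rank V = (N - s)%N.
Proof.
have [eR _ /(row_full_syl _ eR) sR] := gR.
rewrite mxrank_ker (eqP sR) big_split sum_nat_const card_ord /= se nE.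
by rewrite mulnDl [(N * al.+1)%N]mulnS; lia.
Qed.

Lemma lift_top_kernel (y : 'rV[F]_n) : (y <= W)%MS ->
  exists x : 'cV[{poly F}]_n,
    [/\ size_col x (fun=> al.+2), R *m x = 0 & forall j, (x j 0)`_al.+1 = y 0 j].
Proof.
move=> /sub_kermxP yW; have [eR _ sR] := gR.
pose z : 'cV[{poly F}]_n := \col_j ((y 0 j)%:P * 'X^(al.+1)).
have zK : size_col z (fun=> al.+2).
  move=> j; rewrite mxE; apply: size_scaleC; by rewrite size_polyXn.
have [|x xK xE] := sR (R *m z).
  move=> i; have := size_mul_col eR zK i; rewrite addnS => h.
  apply/leq_sizeP => l; rewrite leq_eqVlt => /predU1P[<-|lt].
    rewrite coef_mul_col_top // => [|j j']; last by rewrite ord1.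
    have /matrixP/(_ 0 i) := yW; rewrite !mxE => E; rewrite -[RHS]E.
    apply: eq_bigr => j _; rewrite !mxE mulrC coefCM coefXn eqxx mulr1 //.
  by apply: nth_default; apply: leq_trans h lt.
exists (z - x); split=> [j||j].
- rewrite mxE; apply: size_le_max (zK j) _; rewrite mxE size_polyN.
  exact: leq_trans (xK j) _.
- by rewrite mulmxBr xE subrr.
by rewrite !mxE coefB coefCM coefXn eqxx mulr1 [X in _ - X]nth_default ?subr0 //.
Qed.

Lemma lift_low_kernel (y : 'rV[F]_n) : (y <= V *m T)%MS ->
  exists x : 'cV[{poly F}]_n,
    [/\ size_col x (fun=> al.+1), R *m x = 0 & forall j, (x j 0)`_al = y 0 j].
Proof.
case/submxP=> D ->; rewrite mulmxA topE; have [eR _ _] := gR.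
exists (decode (D *m V)); split=> [||j]; first exact: size_decode.
  by apply/eqP; rewrite -(syl_kernel _ eR) -mulmxA mulmx_ker mulmx0.
by rewrite !mxE.
Qed.

(** [T] is injective on [V]: a kernel vector of degree <= al without X^al term has degree < al and
    vanishes by [col_inj]. *)
Lemma rank_low_top : \rank (V *m T) = (N - s)%N.
Proof.
rewrite -rank_low_kernel; apply/mxrank_injP; have [eR iR _] := gR.
rewrite -submx0; apply/rV_subP => u; rewrite sub_capmx => /andP[/sub_kermxP Vu /sub_kermxP].
rewrite topE => Tu; have u0 : decode u = 0.
  apply: iR => [j|].
    apply/leq_sizeP => l; rewrite leq_eqVlt => /predU1P[<-|lt].
      by have /rowP/(_ j) := Tu; rewrite mxE [RHS]mxE.
    by apply: nth_default; apply: leq_trans (size_decode u j) lt.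
  by apply/eqP; rewrite -(syl_kernel _ eR) Vu.
rewrite submx0 -[u]decodeK u0 /encode mxvec_eq0; apply/eqP/matrixP=> j k.
by rewrite !mxE coef0.
Qed.

(** The coefficient of R x = 0 at X^(e_i + al) in row i is the top coefficient row applied to the
    X^al coefficient of x. *)
Lemma low_top_sub : (V *m T <= W)%MS.
Proof.
apply/rV_subP => y /lift_low_kernel[x [xK Rx xy]]; have [eR _ _] := gR.
apply/sub_kermxP/rowP=> i; rewrite [RHS]mxE.
have /matrixP/(_ i 0)/(congr1 (fun p : {poly F} => p`_(e i + al))) := Rx.
rewrite coef_mul_col_top // => [|j j']; last by rewrite ord1.
have -> : ((0 : 'cV[{poly F}]_r) i 0)`_(e i + al) = 0 by rewrite mxE coef0.
move=> <-; rewrite !mxE; apply: eq_bigr => j _.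
by rewrite !mxE xy mulrC.
Qed.

(* With K = alpha + 1, a constant vector y with top_coef R y = 0 is the
   X^K-coefficient of a kernel vector of degree <= K, because R (X^K y) = R x for
   some x of degree < K.  The rows of degree alpha are completed by such lifts to
   a basis whose matrix of leading coefficients is row free. *)
Lemma kernel_basis : exists B : 'M[{poly F}]_(N, n),
  let k := fun i : 'I_N => if (i < s)%N then al.+1 else al in
  [/\ row_bounded k B, row_free (top_coef k B) & R *m B^T = 0].
Proof.
have NE : N = (s + (N - s))%N by rewrite subnKC.
have [H [fH H1 H2]] : exists H : 'M[F]_(N, n), [/\ row_free H,
    forall i : 'I_N, (i < s)%N -> (row i H <= W)%MS &
    forall i : 'I_N, (s <= i)%N -> (row i H <= V *m T)%MS].
  have := rank_top_kernel; rewrite {1}NE => rW.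
  have [H [fH H1 H2]] := extend_free low_top_sub rank_low_top rW.
  exists (castmx (esym NE, erefl n) H); split.
  - by rewrite /row_free (eqmx_cast _ (_, _)) (eqP fH) subnKC.
  - move=> i iS; apply: submx_trans H1.
    suff -> : row i (castmx (esym NE, erefl n) H) = row (Ordinal iS) (usubmx H) by apply: row_sub.
    by apply/rowP=> j; rewrite !mxE castmxE; congr (H _ _); apply: val_inj.
  move=> i iS; apply: submx_trans H2.
  have iq : (i - s < N - s)%N by rewrite ltn_sub2r // (leq_ltn_trans iS).
  suff -> : row i (castmx (esym NE, erefl n) H) = row (Ordinal iq) (dsubmx H) by apply: row_sub.
  by apply/rowP=> j; rewrite !mxE castmxE; congr (H _ _); apply: val_inj; rewrite //= subnKC.
pose k := fun i : 'I_N => if (i < s)%N then al.+1 else al.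
have hx (i : 'I_N) : exists x : 'cV[{poly F}]_n,
    [/\ size_col x (fun=> (k i).+1), R *m x = 0 & forall j, (x j 0)`_(k i) = H i j].
  rewrite /k; case: ltnP => iS.
    by have [x [x1 x2 x3]] := lift_top_kernel (H1 i iS); exists x; split=> // j; rewrite x3 mxE.
  by have [x [x1 x2 x3]] := lift_low_kernel (H2 i iS); exists x; split=> // j; rewrite x3 mxE.
have [x xP] := fin_all_exists hx; exists (\matrix_(i, j) x i j 0) => /=; split.
- by move=> i j; rewrite mxE; have [h _ _] := xP i; apply: h.
- suff -> : top_coef k (\matrix_(i, j) x i j 0) = H by [].
  by apply/matrixP=> i j; rewrite !mxE; have [_ _ ->] := xP i.
apply/matrixP=> i j; have [_ /matrixP/(_ i 0) h _] := xP j.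
by move: h; rewrite !mxE => h; rewrite -[RHS]h; apply: eq_bigr => l _; rewrite !mxE.
Qed.

(* No kernel vector has degree < alpha, and the kernel vectors of degree alpha
   span an (N - s)-dimensional space, so at most N - s rows have degree alpha. *)
Lemma kernel_min (f : 'I_N -> nat) (B : 'M[{poly F}]_(N, n)) :
  row_bounded f B -> row_free B^f -> R *m B^T = 0 -> (N * al + s <= \sum_i f i)%N.
Proof.
move=> fB freeB RB; have [eR iR _] := gR.
have Rrow i : R *m (row i B)^T = 0.
  have /matrixP h := RB; apply/matrixP=> j j'; have := h j i; rewrite ord1 !mxE => hji.
  by rewrite -[RHS]hji; apply: eq_bigr => l _; rewrite !mxE.
have f_al i : (al <= f i)%N.
  rewrite leqNgt; apply/negP=> fi; have := rsize_gt0 i freeB.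
  suff E : (row i B)^T = 0.
    rewrite lt0n => /negP; apply; rewrite -leqn0; apply/rsizeP => j.
    by have /matrixP/(_ j 0) := E; rewrite !mxE => ->; rewrite size_poly0.
  apply: iR (Rrow i) => j; rewrite !mxE; exact: leq_trans (fB i j) fi.
pose J := [pred i | (f i <= al)%N]; pose g (i : 'I_#|J|) : 'I_N := enum_val i.
pose U := \matrix_(i < #|J|) encode al.+1 (row (g i) B)^T.
have gK i : size_col (row (g i) B)^T (fun=> al.+1).
  by move=> j; rewrite !mxE; have := enum_valP i; rewrite inE => h; apply: leq_trans (fB _ _) _.
have UV : (U <= V)%MS.
  apply/row_subP => i; rewrite rowK; apply/sub_kermxP/eqP.
  by rewrite syl_kernel // encodeK // Rrow.
have fU : row_free U.
  have gi : injective g by apply: enum_val_inj.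
  apply: inj_row_free => c cU.
  (* A constant relation between coefficient vectors is a relation between rows of [B], which are
     independent over the field of fractions. *)
  pose c' := map_mx (@polyC F) c.
  have cB : c' *m rowsub g B = 0.
    apply/rowP=> j; rewrite mxE [RHS]mxE; apply/polyP=> l; rewrite coef0 coef_sum.
    have [lal|lal] := ltnP l al.+1; last first.
      rewrite big1 // => i _; rewrite !mxE coefCM nth_default ?mulr0 //.
      by have := gK i j; rewrite !mxE => h; apply: leq_trans h lal.
    have /rowP/(_ (mxvec_index j (Ordinal lal))) := cU; rewrite !mxE => E.
    rewrite -[RHS]E; apply: eq_bigr => i _; by rewrite !mxE /encode mxvecE !mxE coefCM.
  have /(congr1 (map_mx (@tofrac _))) := cB; rewrite map_mxM map_mx0 => cB'.
  have fg : row_free (rowsub g B)^f by rewrite map_mxsub; apply: rowsub_free.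
  have /tofrac_mx_inj h : c'^f = (0 : 'rV_#|J|)^f.
    by apply: (row_free_inj fg); rewrite cB' map_mx0 mul0mx.
  by apply/rowP=> i; have /rowP/(_ i)/eqP := h; rewrite !mxE polyC_eq0 => /eqP.
have cJ : (#|J| <= N - s)%N by rewrite -(eqP fU) -rank_low_kernel mxrankS.
have -> : (N * al + s = \sum_(i < N) al + s)%N by rewrite sum_nat_const card_ord.
have : (\sum_(i < N) (al + (i \notin J)) <= \sum_i f i)%N.
  apply: leq_sum => i _; have := f_al i; rewrite inE.
  by case: (leqP (f i) al) => /=; lia.
rewrite big_split /= -[X in (_ + X)%N]/(\sum_(i < N) nat_of_bool (i \in [predC J]))%N.
rewrite -big_mkcond /= sum1_card; move=> h; apply: leq_trans h.
have := cardC J; rewrite leq_add2l card_ord => cC.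
by rewrite -(leq_add2l #|J|) cC addnC -leq_subRL.
Qed.

End Kernel.

(** * From good matrices to minimal bases and minimal indices *)

Lemma tr_tofrac_mx (R : idomainType) p q (A : 'M[R]_(p, q)) : (A^f)^T = (A^T)^f.
Proof. by apply/matrixP=> i j; rewrite !mxE. Qed.

Lemma msize_row (r n : nat) (R : 'M[{poly C}]_(r, n)) i : msize (row i R) = rsize R i.
Proof. by rewrite /msize big_ord1; apply: eq_bigr => j _; rewrite mxE. Qed.

Lemma msize_tr (r n : nat) (R : 'M[{poly C}]_(r, n)) : msize R^T = msize R.
Proof.
rewrite /msize exchange_big; apply: eq_bigr => i _.
by apply: eq_bigr => j _; rewrite mxE.
Qed.

Lemma row_bounded_vdeg (r n : nat) (R : 'M[{poly C}]_(r, n)) :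
  row_bounded (fun i => vdeg (row i R)) R.
Proof.
by move=> i j; rewrite /vdeg msize_row; apply: leq_trans (size_rsize R i j) (leqSpred _).
Qed.

Lemma msize_top (r n : nat) (e : 'I_r -> nat) (R : 'M[{poly C}]_(r, n)) i :
  row_bounded e R -> row_free (top_coef e R) -> msize (row i R) = (e i).+1.
Proof.
move=> eR fR; rewrite msize_row; apply/eqP; rewrite eqn_leq; apply/andP; split.
  by apply/rsizeP => j.
rewrite ltnNge; apply/negP=> /rsizeP h.
have /(row_free_inj fR)/matrixP/(_ 0 i)/eqP :
  delta_mx 0 i *m top_coef e R = (0 : 'rV_r) *m top_coef e R.
  rewrite -rowE mul0mx; apply/rowP=> j; rewrite !mxE.
  by apply: nth_default; apply: h.
by rewrite !mxE !eqxx oner_eq0.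
Qed.

(** For another polynomial basis [R'] of the row space, R = D R' over the fractions, so R' x = 0
    implies R x = 0 and [good_min] compares the degree sums. *)
Lemma good_rows_min_basis (r n al : nat) (e : 'I_r -> nat) (R : 'M[{poly C}]_(r, n)) :
  good e al R -> rows_min_basis R.
Proof.
move=> gR; have [eR _ _] := gR; split.
- exact: good_row_free gR.
- by rewrite submx_refl.
move=> R' fR' /andP[_ /submxP[D RE]].
have -> : sum_row_degs R = \sum_i e i.
  by apply: eq_bigr => i _; rewrite /vdeg (msize_top _ eR) // (good_top_free gR).
apply: (good_min gR (row_bounded_vdeg R')) => x R'x; apply: tofrac_mx_inj.
rewrite map_mxM [X in X *m _ = _]RE -mulmxA -map_mxM R'x.
by rewrite /fracmx map_mx0 mulmx0.
Qed.

(** The basis from [kernel_basis] has degree sum N al + s, which is the lower bound of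
    [kernel_min]. *)
Lemma good_min_indices (r n N s al : nat) (e : 'I_r -> nat) (R : 'M[{poly C}]_(r, n)) ix :
  good e al R -> n = (r + N)%N -> (s <= N)%N -> (\sum_i e i = N * al + s)%N ->
  size ix = N -> (forall i, (i < N)%N -> nth 0%N ix i = if (i < s)%N then al.+1 else al) ->
  min_indices (right_null R) ix.
Proof.
move=> gR nE sN se szN; case: _ / szN nE sN se => nE sN se ixE.
have [B [kB fB RB]] := kernel_basis gR nE sN se.
set k := (fun i => _) in kB fB.
have vB i : vdeg (row i B) = k i by rewrite /vdeg (msize_top _ kB).
have freeB : row_free B^f := row_free_top kB fB.
exists B; split; last first.
  suff -> : row_degs B = ix by [].
  apply: (@eq_from_nth _ 0%N); first by rewrite size_map size_enum_ord.
  move=> i; rewrite size_map size_enum_ord => iN; rewrite ixE //.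
  by rewrite (nth_map (Ordinal iN)) ?size_enum_ord // vB /k nth_enum_ord.
have sub : (fracmx B <= right_null R)%MS.
  by apply/sub_kermxP; rewrite -[LHS]trmxK trmx_mul trmxK tr_tofrac_mx -map_mxM RB map_mx0 trmx0.
split=> //.
  rewrite -(mxrank_leqif_eq sub) (eqP freeB) mxrank_ker mxrank_tr.
  by rewrite (eqP (good_row_free gR)) {1}nE addKn.
move=> B' fB' /andP[/sub_kermxP B'R _].
have RB' : R *m B'^T = 0.
  apply: tofrac_mx_inj; rewrite map_mx0 map_mxM.
  by rewrite -[LHS]trmxK trmx_mul tr_tofrac_mx trmxK B'R trmx0.
have := kernel_min gR nE sN se (row_bounded_vdeg B') fB' RB'.
suff -> : sum_row_degs B = (size ix * al + s)%N by [].
rewrite /sum_row_degs (eq_bigr k) => [|i _]; last exact: vB.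
rewrite (eq_bigr (fun i : 'I_(size ix) => al + (i < s))%N); last first.
  by move=> i _; rewrite /k; case: ltnP => _ /=; rewrite ?addn1 ?addn0.
rewrite big_split sum_nat_const card_ord /=; congr (_ + _)%N.
rewrite (eq_bigr (fun i : 'I_(size ix) => if (i < s)%N then 1 else 0)%N); last first.
  by move=> i _; case: ltnP.
by rewrite -big_mkcond (big_ord_narrow sN) sum1_card card_ord.
Qed.

(** * Sums of polynomial blocks placed at prescribed offsets *)

Section Blocks.

Variables (F : fieldType) (B : nat -> nat) (K : nat).
Implicit Type z : nat -> {poly F}.

Lemma size_mulXn_le (p : {poly F}) a b :
  (size p <= b)%N -> (size ('X^a * p)%R <= a + b)%N.
Proof.
move=> pb; have [->|p0] := eqVneq p 0; first by rewrite mulr0 size_poly0.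
by rewrite mulrC size_mulXn // leq_add2l.
Qed.

(** Offsets at least [K] apart keep blocks of size at most [K] disjoint; the blocks are removed from
    the top. *)
Lemma blocks_inj M z :
  (forall j, (j < M)%N -> (B j + K <= B j.+1)%N) ->
  (forall j, (j <= M)%N -> (size (z j) <= K)%N) ->
  \sum_(j < M.+1) 'X^(B j) * z j = 0 -> forall j, (j <= M)%N -> z j = 0.
Proof.
elim: M => [|M IH] BM zK.
  rewrite big_ord1 => /eqP; rewrite mulf_eq0 expf_eq0 polyX_eq0 andbF /= => /eqP z0 j.
  by rewrite leqn0 => /eqP->.
rewrite big_ord_recr /=; set p := \sum_(j < M.+1) _ => E.
have Bmono j : (j <= M)%N -> (B j + K <= B M.+1)%N.
  move=> jM; have : (B j <= B M)%N; last by have := BM M (ltnSn M); lia.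
  move: jM; elim: {-2}M (leqnn M) => [|M' IH'] M'M; first by rewrite leqn0 => /eqP->.
  rewrite leq_eqVlt => /predU1P[-> //|]; rewrite ltnS => /IH' h.
  by have := BM M' (leqW M'M); have := h (ltnW M'M); lia.
have sp : (size p <= B M.+1)%N.
  apply: leq_trans (size_sum _ _ _) _; apply/bigmax_leqP => j _.
  have jM : (j <= M)%N by rewrite -ltnS.
  by apply: leq_trans (size_mulXn_le _ (zK j (leqW jM))) _; apply: Bmono.
have zM : z M.+1 = 0.
  apply/polyP=> l; rewrite coef0; have := congr1 (fun q : {poly F} => q`_(B M.+1 + l)) E.
  rewrite coefD coefXnM ltnNge leq_addr /= addKn coef0 nth_default ?add0r //.
  exact: leq_trans sp (leq_addr _ _).
move: E; rewrite zM mulr0 addr0 => p0 j; rewrite leq_eqVlt => /predU1P[->//|].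
rewrite ltnS; apply: IH => // [i iM|i iM]; [exact/BM/leqW|exact/zK/leqW].
Qed.

(** Offsets at most [K] apart leave no gap; [p] is cut at the last offset and the lower part is
    decomposed recursively. *)
Lemma blocks_surj M (p : {poly F}) :
  B 0%N = 0%N -> (forall j, (j < M)%N -> (B j.+1 <= B j + K)%N) ->
  (size p <= B M + K)%N ->
  exists2 z : nat -> {poly F}, (forall j, (size (z j) <= K)%N) & \sum_(j < M.+1) 'X^(B j) * z j = p.
Proof.
move=> B0; elim: M p => [|M IH] p BM pK.
  exists (fun j => if j == 0%N then p else 0).
    by case=> [|j] /=; rewrite ?size_poly0 //; move: pK; rewrite B0.
  by rewrite big_ord1 B0 mul1r.
have [||z zK zE] := IH (take_poly (B M.+1) p).
- by move=> j jM; apply/BM/leqW.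
- exact: leq_trans (size_take_poly _ _) (BM _ (ltnSn _)).
exists (fun j => if j == M.+1 then drop_poly (B M.+1) p else z j).
  by move=> j; case: eqP => _ //; rewrite size_drop_poly leq_subLR.
rewrite big_ord_recr /= eqxx -[RHS](poly_take_drop (B M.+1)) -zE.
congr (_ + _); last by rewrite mulrC.
by apply: eq_bigr => j _; rewrite ltn_eqF.
Qed.

Lemma mulXn_drop (p : {poly F}) m :
  (forall l, (l < m)%N -> p`_l = 0) -> p = 'X^m * drop_poly m p.
Proof.
move=> h; apply/polyP=> l; rewrite coefXnM coef_drop_poly.
by case: ltnP => [/h//|ml]; rewrite subnK.
Qed.

End Blocks.

Lemma big_ltS (T : Type) (x : T) (op : Monoid.com_law x) r (f : 'I_r -> T) (i : 'I_r) :
  \big[op/x]_(l < r | (l < i.+1)%N) f l = op (f i) (\big[op/x]_(l < r | (l < i)%N) f l).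
Proof.
rewrite (bigD1 i) //=; congr (op _ _); apply: eq_bigl => l.
by rewrite ltnS [in RHS]ltn_neqAle andbC.
Qed.

(** * An explicit good matrix for arbitrary row degrees *)

Section Witness.

Variables (F : fieldType) (r N : nat) (e : 'I_r -> nat).
Hypotheses (r0 : (0 < r)%N) (N0 : (0 < N)%N).

Let a := (\sum_i e i)%N.
Let D k := (\sum_(i < r | (i < k)%N) e i)%N.
Let B j := ((j * a) %/ N)%N.
Let al := (a %/ N)%N.

Lemma degS (i : 'I_r) : D i.+1 = (e i + D i)%N.
Proof. by rewrite /D big_ltS. Qed.

Lemma deg_total : D r = a.
Proof. by apply: eq_bigl => i; rewrite ltn_ord. Qed.

Lemma deg_mono k l : (k <= l)%N -> (D k <= D l)%N.
Proof.
move=> kl; rewrite /D big_mkcond [X in (_ <= X)%N]big_mkcond; apply: leq_sum => i _.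
by case: ltnP => // ik; rewrite (leq_trans ik kl).
Qed.

(** The intervals from D_i to D_(i+1) cover 0, ..., a; the least k with t <= D_k selects one. *)
Lemma owner_exists t : (t <= a)%N -> exists i : 'I_r, (D i <= t <= D i.+1)%N.
Proof.
move=> ta; have h : exists k, (t <= D k)%N by exists r; rewrite deg_total.
case: (ex_minnP h) => -[|k] tk mink.
  exists (Ordinal r0); have D0 : D 0%N = 0%N by rewrite /D big_pred0.
  by rewrite D0 /=; move: tk; rewrite D0 leqn0 => /eqP->.
have kr : (k < r)%N by apply: mink; rewrite deg_total.
exists (Ordinal kr); rewrite tk andbT /= leqNgt; apply/negP=> tD.
by have := mink k (ltnW tD); rewrite ltnn.
Qed.

(** Consecutive offsets differ by [al] or [al.+1], as [blocks_inj] with K = al and [blocks_surj]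
    with K = al + 1 require. *)
Lemma block_step j : (B j + al <= B j.+1)%N /\ (B j.+1 <= B j + al.+1)%N.
Proof.
have E : (j.+1 * a = al * N + (j * a + a %% N))%N.
  by rewrite mulSn {1}(divn_eq a N) -/al; lia.
rewrite /B E divnMDl //; split; first by rewrite addnC leq_add2l leq_div2r // leq_addr.
have : ((j * a + a %% N) %/ N <= (1 * N + j * a) %/ N)%N.
  by apply: leq_div2r; rewrite mul1n addnC leq_add2r ltnW // ltn_pmod.
by rewrite divnMDl //; lia.
Qed.

Lemma block_last : B N = a.
Proof. by rewrite /B mulKn. Qed.

(** The value 0 at index [r] lets the last row, which has no successor, follow the general
    formula. *)
Let ext (y : 'cV[{poly F}]_r) (k : nat) : {poly F} :=
  if insub k is Some i then y i ord0 else 0.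

Lemma ext_ord y (i : 'I_r) : ext y i = y i ord0.
Proof. by rewrite /ext valK. Qed.

Lemma ext_r y : ext y r = 0.
Proof. by rewrite /ext insubF // ltnn. Qed.

Variable o : 'I_N -> 'I_r.
Hypothesis oP : forall j : 'I_N, (D (o j) <= B j.+1 <= D (o j).+1)%N.

(* The unknowns are y_0, ..., y_(r-1), z_1, ..., z_N, and row i reads
   y_i - X^(e_i) y_(i+1) + sum of X^(B_j - D_i) z_j over the j owned by i, where
   D_i = e_0 + ... + e_(i-1), B_j = floor (j a / N) and D_i <= B_j <= D_(i+1). *)
Definition witness : 'M[{poly F}]_(r, r + N) :=
  row_mx (\matrix_(i, i') if i' == i then 1 else if i' == i.+1 :> nat then - 'X^(e i) else 0)
         (\matrix_(i, j) if o j == i then 'X^(B j.+1 - D i) else 0).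

Lemma witness_bounded : row_bounded e witness.
Proof.
move=> i j; rewrite mxE; case: split => j'; rewrite mxE.
  case: eqP => _; first by rewrite size_poly1.
  by case: eqP => _; rewrite ?size_polyN ?size_polyXn ?size_poly0.
case: eqP => [oi|_]; last by rewrite size_poly0.
by rewrite size_polyXn ltnS leq_subLR addnC -degS -oi; have /andP[] := oP j'.
Qed.

Lemma witness_row (x : 'cV[{poly F}]_(r + N)) (i : 'I_r) :
  (witness *m x) i 0 = usubmx x i 0 - 'X^(e i) * ext (usubmx x) i.+1
    + \sum_(j | o j == i) 'X^(B j.+1 - D i) * dsubmx x j 0.
Proof.
rewrite -[x in LHS]vsubmxK mul_row_col mxE; congr (_ + _); last first.
  rewrite mxE [RHS]big_mkcond; apply: eq_bigr => j _; rewrite mxE.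
  by case: ifP => //; rewrite mul0r.
rewrite mxE (bigD1 i) //= mxE eqxx mul1r; congr (_ + _).
rewrite /ext; case: insubP => [i' i'r i'E|ir].
  have i'i : i' != i by apply/eqP=> E; have := i'E; rewrite E => /eqP; rewrite /= eqn_leq ltnn andbF.
  rewrite (bigD1 i') //= mxE (negbTE i'i) i'E eqxx mulNr big1 ?addr0 // => l /andP[li li'].
  by rewrite mxE (negbTE li) -i'E (inj_eq val_inj) (negbTE li') mul0r.
rewrite mulr0 oppr0 big1 // => l li; rewrite mxE (negbTE li).
by case: eqP => [E|_]; rewrite ?mul0r //; rewrite -E ltn_ord in ir.
Qed.

Lemma sum_owner_ltS (f : 'I_N -> {poly F}) (i : 'I_r) :
  \sum_(j | (o j < i.+1)%N) f j = \sum_(j | o j == i) f j + \sum_(j | (o j < i)%N) f j.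
Proof.
rewrite (bigID (fun j => o j == i)) /=; congr (_ + _); apply: eq_bigl => j.
  by case: eqP => [->|]; rewrite ?ltnSn ?andbF.
by rewrite ltnS andbC [in RHS]ltn_neqAle.
Qed.

(* Multiplying row i by X^(D i) makes the sum of the rows telescope. *)
Lemma witness_telescope (x : 'cV[{poly F}]_(r + N)) k : (k <= r)%N ->
  \sum_(i < r | (i < k)%N) 'X^(D i) * (witness *m x) i 0
  = ext (usubmx x) 0 - 'X^(D k) * ext (usubmx x) k
    + \sum_(j | (o j < k)%N) 'X^(B j.+1) * dsubmx x j 0.
Proof.
elim: k => [|k IH] kr.
  by rewrite !big_pred0 // /D big_pred0 // mul1r subrr addr0.
pose i := Ordinal kr; rewrite (big_ltS _ _ i) /= (IH (ltnW kr)) (sum_owner_ltS _ i).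
have DkS : D k.+1 = (e i + D k)%N := degS i.
rewrite (witness_row x i) DkS exprD.
have -> : ext (usubmx x) k = usubmx x i 0 by rewrite -ext_ord.
have E : 'X^(D k) * (\sum_(j | o j == i) 'X^(B j.+1 - D i) * dsubmx x j 0)
    = \sum_(j | o j == i) 'X^(B j.+1) * dsubmx x j 0.
  rewrite mulr_sumr; apply: eq_bigr => j /eqP oj; rewrite mulrA -exprD subnKC //.
  by have /andP[] := oP j; rewrite oj.
by rewrite mulrDr E; ring.
Qed.

Lemma block_sum (x : 'cV[{poly F}]_(r + N)) (z : nat -> {poly F}) :
  z 0%N = ext (usubmx x) 0 -> (forall j : 'I_N, z j.+1 = dsubmx x j 0) ->
  \sum_(j < N.+1) 'X^(B j) * z j = \sum_(i < r) 'X^(D i) * (witness *m x) i 0.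
Proof.
move=> z0 zS; have := witness_telescope x (leqnn r).
rewrite (eq_bigl xpredT) => [->|i]; last by rewrite ltn_ord.
rewrite ext_r mulr0 subr0 [in RHS](eq_bigl xpredT) => [|j]; last by rewrite ltn_ord.
rewrite big_ord_recl z0 /B mul0n div0n mul1r; congr (_ + _).
by apply: eq_bigr => j _; rewrite -zS.
Qed.

(** The telescoped sum is a block sum with y_0 as block 0, so y_0 and all z_j vanish; row i then
    gives y_(i+1) = 0 from y_i = 0. *)
Lemma witness_inj : col_inj al witness.
Proof.
move=> x xK Wx; pose z k := if k is j.+1 then
  (if insub j is Some j' then dsubmx x j' ord0 else 0) else ext (usubmx x) 0.
have zS (j : 'I_N) : z j.+1 = dsubmx x j 0 by rewrite /z valK.
have := block_sum (erefl : z 0%N = _) zS; rewrite [RHS]big1 => [E|i _]; last first.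
  by rewrite Wx mxE mulr0.
have zz j : (j <= N)%N -> z j = 0.
  apply: (@blocks_inj F B al N z _ _ E) => [l lN|l lN]; first by have [] := block_step l.
  case: l lN => [|l] lN.
    have -> : z 0%N = usubmx x (Ordinal r0) 0 by rewrite -ext_ord.
    by rewrite mxE; apply: xK.
  by have -> := zS (Ordinal lN); rewrite mxE; apply: xK.
have yz k : ext (usubmx x) k = 0.
  elim: k => [|k IH]; first exact: (zz 0%N).
  have [kr|kr] := ltnP k r; last by rewrite /ext insubF // ltnNge (leqW kr).
  have := witness_row x (Ordinal kr); rewrite Wx mxE -ext_ord IH sub0r.
  rewrite big1 => [|j _]; last by rewrite -zS zz ?mulr0 // ltn_ord.
  move=> /esym/eqP; rewrite addr0 oppr_eq0 mulf_eq0 expf_eq0 polyX_eq0 andbF /=.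
  by move/eqP.
rewrite -[x]vsubmxK; apply/colP=> i; rewrite [RHS]mxE mxE.
case: split => j; first by rewrite -ext_ord yz.
by rewrite -zS zz // ltn_ord.
Qed.

Lemma witness_surj : col_surj e al.+1 witness.
Proof.
move=> c cK; pose p := \sum_(i < r) 'X^(D i) * c i 0.
have XcK (i : 'I_r) k : (i < k)%N -> (size ('X^(D i) * c i 0)%R <= D k + al.+1)%N.
  move=> ik; apply: leq_trans (size_mulXn_le _ (cK i)) _.
  by rewrite addnA leq_add2r addnC -degS deg_mono.
have [|||z zK zE] := @blocks_surj F B al.+1 N p.
- by rewrite /B mul0n div0n.
- by move=> j _; have [] := block_step j.
- rewrite block_last -deg_total; apply: leq_trans (size_sum _ _ _) _.
  by apply/bigmax_leqP => i _; apply: XcK.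
(* Solving the telescoped identity, with y_0 = z_0, for X^(D_k) y_k gives [w k]. *)
pose w k := z 0%N + \sum_(j | (o j < k)%N) 'X^(B j.+1) * z j.+1
  - \sum_(i < r | (i < k)%N) 'X^(D i) * c i 0.
have B0 : 'X^(B 0) = 1 :> {poly F} by rewrite /B mul0n div0n.
(* The defining form of [w k] bounds its degree; this complementary form shows that X^(D_k) divides
   it. *)
have wE k : w k = \sum_(i < r | ~~ (i < k)%N) 'X^(D i) * c i 0
    - \sum_(j | ~~ (o j < k)%N) 'X^(B j.+1) * z j.+1.
  have := zE; rewrite big_ord_recl B0 mul1r /p.
  rewrite (bigID (fun j : 'I_N => (o j < k)%N)) /= [RHS](bigID (fun i : 'I_r => (i < k)%N)) /=.
  rewrite /w; move: (z 0%N) (\sum_(j | (o j < k)%N) _) (\sum_(j | ~~ (o j < k)%N) _).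
  move=> z0 S1 S2 E; rewrite -[z0](addrK (S1 + S2)) E; ring.
have wr : w r = 0.
  by rewrite wE !big_pred0 ?subrr // => j; rewrite ltn_ord.
have wdiv k : w k = 'X^(D k) * drop_poly (D k) (w k).
  apply: mulXn_drop => l lD; rewrite wE coefB !coef_sum !big1 ?subrr // => i.
    rewrite -leqNgt => ki; rewrite coefXnM (leq_trans lD) //.
    by have /andP[h _] := oP i; apply: leq_trans (deg_mono ki) h.
  by rewrite -leqNgt => ki; rewrite coefXnM (leq_trans lD) // deg_mono.
have wK k : (size (w k) <= D k + al.+1)%N.
  apply: size_le_max; last first.
    rewrite size_polyN; apply: leq_trans (size_sum _ _ _) _.
    by apply/bigmax_leqP => i; apply: XcK.
  apply: size_le_max; first exact: leq_trans (zK 0%N) (leq_addl _ _).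
  apply: leq_trans (size_sum _ _ _) _; apply/bigmax_leqP => j jk.
  apply: leq_trans (size_mulXn_le _ (zK j.+1)) _; rewrite leq_add2r.
  by have /andP[_ h] := oP j; apply: leq_trans h (deg_mono jk).
pose y : 'cV[{poly F}]_r := \col_i drop_poly (D i) (w i).
pose x := col_mx y (\col_(j < N) z j.+1); exists x.
  move=> i; rewrite mxE; case: split => i'; rewrite mxE ?zK //.
  by rewrite size_drop_poly leq_subLR.
have yw k : (k <= r)%N -> 'X^(D k) * ext y k = w k.
  rewrite leq_eqVlt => /predU1P[->|kr]; first by rewrite ext_r mulr0 wr.
  by have -> := ext_ord y (Ordinal kr); rewrite mxE /= -wdiv.
apply/colP=> i; have X0 : 'X^(D i) != 0 :> {poly F} by rewrite expf_eq0 polyX_eq0 andbF.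
apply: (mulfI X0); rewrite witness_row col_mxKu col_mxKd mulrDr mulrBr mulrA -exprD.
rewrite [(D i + e i)%N]addnC -degS yw // -(ext_ord y) yw 1?ltnW // mulr_sumr.
rewrite (eq_bigr (fun j : 'I_N => 'X^(B j.+1) * z j.+1)) => [|j /eqP oj]; last first.
  rewrite mxE mulrA -exprD subnKC //.
  by have /andP[] := oP j; rewrite oj.
rewrite /w sum_owner_ltS big_ltS /=; ring.
Qed.

End Witness.

Lemma good_exists (F : fieldType) (r N : nat) (e : 'I_r -> nat) :
  (0 < r)%N -> (0 < N)%N ->
  exists R : 'M[{poly F}]_(r, r + N), good e ((\sum_i e i) %/ N)%N R.
Proof.
move=> r0 N0.
have [|o oP] := @fin_all_exists _ (fun=> 'I_r) (fun (j : 'I_N) (i : 'I_r) =>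
  (\sum_(l < r | (l < i)%N) e l <= (j.+1 * \sum_l e l) %/ N
   <= \sum_(l < r | (l < i.+1)%N) e l)%N).
  move=> j; apply: owner_exists => //.
  by rewrite -{2}[(\sum_i e i)%N](mulKn _ N0) leq_div2r // leq_mul2r ltn_ord orbT.
exists (@witness F r N e o); split.
- exact: witness_bounded oP.
- exact: (@witness_inj F r N e r0 N0 o oP).
- exact: (@witness_surj F r N e r0 N0 o oP).
Qed.

(** * Genericity of the rank conditions along a line *)

(** For a right inverse [Y] at [t1], the determinant of (t D + A) Y is a polynomial in t with value
    1 at [t1]. *)
Lemma pencil_free (F : fieldType) m n (A D : 'M[F]_(m, n)) (t1 : F) :
  row_free (t1 *: D + A)%R ->
  exists2 p : {poly F}, p != 0 & forall t, p.[t] != 0 -> row_free (t *: D + A)%R.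
Proof.
case/row_freeP=> Y tY.
pose M := ('X *: map_mx (@polyC F) D + map_mx (@polyC F) A) *m map_mx (@polyC F) Y.
have Mt t : (\det M).[t] = \det ((t *: D + A) *m Y).
  rewrite -horner_evalE -det_map_mx map_mxM map_mxD map_mxZ /= /horner_eval hornerX.
  congr (\det ((_ *: _ + _) *m _)); apply/matrixP=> i j; by rewrite !mxE /= hornerC.
exists (\det M).
  by apply/eqP=> M0; have := Mt t1; rewrite M0 horner0 tY det1 => /esym/eqP; rewrite oner_eq0.
move=> t; rewrite Mt => dt.
have : row_free ((t *: D + A) *m Y) by rewrite row_free_unit unitmxE unitfE.
rewrite /row_free !eqn_leq !rank_leq_row /= => h.
exact: leq_trans h (mxrankM_maxl _ _).
Qed.

Lemma row_full_tr (F : fieldType) m n (A : 'M[F]_(m, n)) : row_full A = row_free A^T.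
Proof. by rewrite /row_full /row_free mxrank_tr. Qed.

Lemma pencil_full (F : fieldType) m n (A D : 'M[F]_(m, n)) (t1 : F) :
  row_full (t1 *: D + A)%R ->
  exists2 p : {poly F}, p != 0 & forall t, p.[t] != 0 -> row_full (t *: D + A)%R.
Proof.
have E t : (t *: D + A)^T = t *: D^T + A^T by apply/matrixP=> i j; rewrite !mxE.
rewrite row_full_tr E => /pencil_free[p p0 hp]; exists p => // t /hp.
by rewrite (row_full_tr (t *: D + A)) E.
Qed.

(** The line passes through [R] at t = 0 and through a good matrix at t = 1; each rank condition can
    fail only at the roots of a nonzero polynomial. *)
Lemma good_generic (F : fieldType) (r n N : nat) (e : 'I_r -> nat) (R : 'M[{poly F}]_(r, n)) :
  n = (r + N)%N -> (0 < r)%N -> (0 < N)%N -> row_bounded e R ->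
  exists (D : 'M[{poly F}]_(r, n)) (p : {poly F}), p != 0 /\
    forall t, p.[t] != 0 -> good e ((\sum_i e i) %/ N)%N (t%:P *: D + R).
Proof.
move=> nE r0 N0 eR; move: R eR; rewrite {n}nE => R eR.
have [R0 [eR0 iR0 sR0]] := @good_exists F r N e r0 N0.
set al := (_ %/ N)%N in iR0 sR0 *; pose D := R0 - R.
have eD t : row_bounded e (t%:P *: D + R).
  move=> i j; rewrite !mxE; apply: size_le_max (eR i j); apply: size_scaleC.
  by apply: size_le_max (eR0 i j) _; rewrite size_polyN; apply: eR.
have R1 K : syl e K R0 = 1 *: syl e K D + syl e K R.
  by rewrite -syl_linear scale1r subrK.
have /(row_free_syl al eR0) := iR0; rewrite R1 => /pencil_free[p p0 hp].
have /(row_full_syl al.+1 eR0) := sR0; rewrite R1 => /pencil_full[q q0 hq].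
exists D, (p * q); split=> [|t]; first by rewrite mulf_neq0.
rewrite hornerM mulf_eq0 negb_or => /andP[/hp ht /hq ht']; split=> //.
  by apply/(row_free_syl _ (eD t)); rewrite syl_linear.
by apply/(row_full_syl _ (eD t)); rewrite syl_linear.
Qed.

(** * The balanced degrees, and approximation by elements of [MHset] *)

Section Target.

Variables (m n r d a : nat).
Hypotheses (r0 : (0 < r)%N) (rmn : (r < minn m n)%N) (ard : (a <= r * d)%N).

Definition target (i : 'I_r) : nat := if (i < tR r a)%N then (dR r a).+1 else dR r a.

Lemma target_le i : (target i <= d)%N.
Proof.
rewrite /target /tR /dR; have dd : (a %/ r <= d)%N.
  by rewrite -(mulKn d r0) leq_div2r.
case: ltnP => // it; rewrite ltn_neqAle dd andbT; apply/eqP=> E.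
have := divn_eq a r; rewrite E => aE; move: ard; rewrite aE mulnC -{2}[(r * d)%N]addn0 leq_add2l.
by rewrite leqn0 => /eqP z; rewrite z in it.
Qed.

Lemma sum_target : (\sum_i target i = a)%N.
Proof.
rewrite (eq_bigr (fun i : 'I_r => dR r a + (i < tR r a))%N); last first.
  by move=> i _; rewrite /target; case: ltnP; rewrite ?addn1 ?addn0.
rewrite big_split sum_nat_const card_ord /=.
rewrite (eq_bigr (fun i : 'I_r => if (i < tR r a)%N then 1 else 0)%N); last first.
  by move=> i _; case: ltnP.
have tr : (tR r a <= r)%N by rewrite ltnW // ltn_pmod.
rewrite -big_mkcond (big_ord_narrow tr) sum1_card card_ord.
by rewrite {3}(divn_eq a r) mulnC.
Qed.

Lemma sum_target_compl : (\sum_i (d - target i) = r * d - a)%N.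
Proof.
apply/eqP; rewrite -(eqn_add2r a) subnK // -{1}sum_target -big_split /=.
rewrite (eq_bigr (fun=> d)) ?sum_nat_const ?card_ord // => i _.
by rewrite subnK // target_le.
Qed.

Lemma balanced_indices N al s : (s <= N)%N ->
  size (nseq s al.+1 ++ nseq (N - s) al) = N /\
  forall i, (i < N)%N ->
    nth 0%N (nseq s al.+1 ++ nseq (N - s) al) i = if (i < s)%N then al.+1 else al.
Proof.
move=> sN; split; first by rewrite size_cat !size_nseq subnKC.
move=> i iN; rewrite nth_cat size_nseq !nth_nseq; case: ltnP => // si.
by rewrite ltn_sub2r // (leq_ltn_trans si).
Qed.

Lemma good_balanced_indices k (e : 'I_r -> nat) (R : 'M[{poly C}]_(r, k)) (b : nat) :
  (r < k)%N -> (\sum_i e i)%N = b -> good e (b %/ (k - r))%N R ->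
  min_indices (right_null R)
    (nseq (b %% (k - r))%N (b %/ (k - r)).+1%N ++
     nseq (k - r - b %% (k - r))%N (b %/ (k - r))%N).
Proof.
move=> rk se gR; have N0 : (0 < k - r)%N by rewrite subn_gt0.
have sN : (b %% (k - r) <= k - r)%N by rewrite ltnW // ltn_pmod.
have [sz nthE] := balanced_indices (b %/ (k - r))%N sN.
apply: (good_min_indices gR _ sN _ sz nthE); first by rewrite subnKC // ltnW.
by rewrite se {1}(divn_eq b (k - r)%N) mulnC.
Qed.

Lemma good_has_deg k al (e : 'I_r -> nat) (R : 'M[{poly C}]_(r, k)) i :
  good e al R -> has_deg (row i R) (e i).
Proof. by move=> gR; have [eR _ _] := gR; apply: msize_top eR (good_top_free gR). Qed.

(** The conditions on [L] are those on a right factor, read for [L^T] with row degrees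
    [d - target i] of sum [r * d - a]. *)
Lemma good_MHset (L : 'M[{poly C}]_(m, r)) (R : 'M[{poly C}]_(r, n)) :
  good target (a %/ (n - r))%N R ->
  good (fun i => d - target i)%N ((r * d - a) %/ (m - r))%N L^T ->
  MHset r d a (L *m R).
Proof.
move: (rmn); rewrite ltn_min => /andP[rm rn] gR gL; exists L, R; split=> //.
- move=> i; split; first exact: good_has_deg gR.
  by have := good_has_deg i gL; rewrite /has_deg -tr_col msize_tr.
- exact: good_rows_min_basis gL.
- exact: good_rows_min_basis gR.
split; last exact: good_balanced_indices sum_target gR.
have := good_balanced_indices rm sum_target_compl gL.
by rewrite /right_null /fracmx -tr_tofrac_mx trmxK.
Qed.

Lemma prodset_approx_MHset (P : 'M[{poly C}]_(m, n)) :
  prodset d target P -> approx (MHset r d a) P.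
Proof.
move: (rmn); rewrite ltn_min => /andP[rm rn] [L [R [hR hL PE]]].
have [D [p [p0 hp]]] : exists (D : 'M[{poly C}]_(r, n)) (p : {poly C}), p != 0 /\
    forall t, p.[t] != 0 -> good target (a %/ (n - r))%N (t%:P *: D + R).
  have := @good_generic _ r n (n - r) target R; rewrite sum_target; apply=> //.
    by rewrite subnKC // ltnW.
  by rewrite subn_gt0.
have [E [q [q0 hq]]] : exists (E : 'M[{poly C}]_(r, m)) (q : {poly C}), q != 0 /\
    forall t, q.[t] != 0 ->
      good (fun i => d - target i)%N ((r * d - a) %/ (m - r))%N (t%:P *: E + L^T).
  have := @good_generic _ r m (m - r) (fun i => d - target i)%N L^T.
  rewrite sum_target_compl; apply=> //.
  - by rewrite subnKC // ltnW.
  - by rewrite subn_gt0.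
  by move=> i j; rewrite mxE; apply: hL.
(* Both factors move along lines with the same parameter, so the product is quadratic in t. *)
apply: (@approx_curve _ _ _ _ (E^T *m R + L *m D) (E^T *m D) (p * q)).
  by rewrite mulf_neq0.
move=> t _; rewrite hornerM mulf_eq0 negb_or => /andP[/hp gR /hq gL].
have -> : P + t%:P *: (E^T *m R + L *m D) + (t ^+ 2)%:P *: (E^T *m D)
    = (t%:P *: E^T + L) *m (t%:P *: D + R).
  rewrite mulmxDl !mulmxDr -!scalemxAl -!scalemxAr PE rmorphXn /=.
  move: (L *m R) (E^T *m R) (L *m D) (E^T *m D) t%:P => x y z w u.
  by apply/matrixP=> i j; rewrite !mxE; ring.
apply: good_MHset gR _; rewrite linearD linearZ /= trmxK; exact: gL.
Qed.

Lemma Bset_prodset (P : 'M[{poly C}]_(m, n)) : Bset r d a P -> prodset d target P.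
Proof.
case=> L [R [deg ->]]; exists L, R; split=> // [i j|k i].
  have [<- _] := deg i; rewrite msize_row; exact: size_rsize.
have [_ <-] := deg i; rewrite -msize_tr tr_col msize_row.
by have := size_rsize L^T i k; rewrite mxE.
Qed.

Lemma MHset_Mset (P : 'M[{poly C}]_(m, n)) : MHset r d a P -> Mset r d a P.
Proof. by case=> L [R [h1 h2 h3 _ h4]]; exists L, R. Qed.

Lemma Mset_Bset (P : 'M[{poly C}]_(m, n)) : Mset r d a P -> Bset r d a P.
Proof. by case=> L [R [h1 _ _ h4]]; exists L, R. Qed.

End Target.

(** * Limits of products with inner dimension r *)

Lemma rank_cut (K : fieldType) m n k (M : 'M[K]_(m, n)) : (k <= \rank M)%N ->
  exists (A : 'M[K]_(k, m)) (B : 'M[K]_(n, k)), A *m M *m B = 1%:M.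
Proof.
move=> kM; exists (pid_mx k *m invmx (col_ebase M)), (invmx (row_ebase M) *m pid_mx k).
rewrite -{2}(mulmx_ebase M) -!mulmxA (mulKVmx (row_ebase_unit M)) (mulKmx (col_ebase_unit M)).
rewrite mul_pid_mx (minn_idPr kM) (minn_idPr (leq_trans kM (rank_leq_col M))).
rewrite mul_pid_mx minnn (minn_idPr (leq_trans kM (rank_leq_row M))).
by rewrite pid_mx_1.
Qed.

(** If v c = v W, the sum S of the |v_j| satisfies |c| S <= k delta S, so S = 0. *)
Lemma near_scalar_free k (c delta : C) (W : 'M[C]_k) :
  (forall i j, `|W i j| <= delta) -> k%:R * delta < `|c| -> row_free (c%:M - W).
Proof.
move=> hW kd; apply: inj_row_free => v; rewrite mulmxBr mul_mx_scalar => /eqP.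
rewrite subr_eq0 => /eqP E.
have S0 : 0 <= \sum_j `|v 0 j| by apply: sumr_ge0.
have : `|c| * \sum_j `|v 0 j| <= k%:R * delta * \sum_j `|v 0 j|.
  rewrite mulr_sumr; apply: (@le_trans _ _ (\sum_(j < k) \sum_i `|v 0 i| * delta)).
    apply: ler_sum => j _; rewrite -normrM.
    have -> : c * v 0 j = \sum_i v 0 i * W i j by have /rowP/(_ j) := E; rewrite !mxE.
    apply: le_trans (ler_norm_sum _ _ _) _; apply: ler_sum => i _.
    by rewrite normrM; apply: ler_wpM2l (hW i j).
  by rewrite sumr_const card_ord -mulr_suml -mulrA mulr_natl (mulrC delta).
rewrite -subr_ge0 -mulrBl => h.
have {h} : \sum_j `|v 0 j| = 0.
  apply/eqP; rewrite eq_le S0 andbT.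
  by move: h; rewrite nmulr_rge0 // subr_lt0.
move=> /eqP; rewrite psumr_eq0 // => /allP h; apply/rowP=> j; rewrite mxE.
by have := h j; rewrite mem_index_enum normr_eq0 => /(_ isT)/eqP.
Qed.

Lemma entry_bound m n (A : 'M[C]_(m, n)) :
  exists2 M : C, 0 < M & forall i j, `|A i j| <= M.
Proof.
have [M M0 h] := coef_bound (map_mx (@poly.polyC C) A); exists M => // i j.
by have := h i j 0%N; rewrite mxE coefC eqxx.
Qed.

(** If the rank exceeded r, some A P B would be the identity of size r + 1; cleared of denominators
    and evaluated at a point, it is an invertible scalar matrix. A close enough Q keeps the result
    invertible, although Q factors through dimension r. *)
Lemma approx_rank (m n r d : nat) (S : 'M[{poly C}]_(m, n) -> Prop) P :
  (forall Q, S Q -> deg_le Q d) -> deg_le P d ->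
  (forall Q, S Q -> exists (L : 'M_(m, r)) (R : 'M_(r, n)), Q = L *m R) ->
  approx S P -> (normal_rank P <= r)%N.
Proof.
move=> dS dP hS aP; rewrite leqNgt; apply/negP=> /rank_cut[A [B AB]].
have [cA [A' [cA0 AE]]] := clear_denominators A.
have [cB [B' [cB0 BE]]] := clear_denominators B.
have E : A' *m P *m B' = (cA * cB)%:M.
  apply: tofrac_mx_inj; rewrite /= !map_mxM /= AE BE map_scalar_mx -!scalemxAl -scalemxAr AB.
  by rewrite scalerA scalemx1 /= tofracM.
have c0 : cA * cB != 0 by rewrite mulf_neq0.
(* Taking x positive makes |x| = x in the bounds on evaluations. *)
have [x [x0 _ cx]] := small_nonroot c0 ltr01.
set c := (cA * cB).[x] in cx.
pose ev p q (M : 'M[{poly C}]_(p, q)) : 'M[C]_(p, q) := map_mx (horner_eval x) M.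
have {}E : ev _ _ A' *m ev _ _ P *m ev _ _ B' = c%:M.
  by rewrite -!map_mxM E map_scalar_mx.
have [MU U0 hU] := entry_bound (ev _ _ A'); have [MV V0 hV] := entry_bound (ev _ _ B').
set U := ev _ _ A' in E hU; set V := ev _ _ B' in E hV.
pose G : C := \sum_(l < d.+1) x ^+ l.
have G0 : 0 <= G by apply: sumr_ge0 => l _; rewrite exprn_ge0 // ltW.
(* By the triangle inequality, r + 1 times the bound on the entries of U D V is [eps * Z]; the [+ 1]
   in the denominator of [eps] makes this smaller than |c|. *)
pose Z : C := r.+1%:R * (n%:R * (m%:R * (MU * G) * MV)).
have Z0 : 0 <= Z by rewrite !mulr_ge0 ?ler0n // ltW.
have Z1 : 0 < Z + 1 by rewrite ltr_wpDl ?ltr01.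
have c1 : 0 < `|c| by rewrite normr_gt0.
pose eps := `|c| / (Z + 1); have eps0 : 0 < eps by rewrite divr_gt0.
have [Q SQ hQ] := aP _ eps0; have dQ := dS _ SQ.
pose D := ev _ _ P - ev _ _ Q.
have hD i j : `|D i j| <= eps * G.
  rewrite !mxE /horner_eval -hornerN -hornerD (@horner_coef_wide _ d.+1); last first.
    by apply: size_le_max (dP i j) _; rewrite size_polyN; apply: dQ.
  apply: le_trans (ler_norm_sum _ _ _) _; rewrite mulr_sumr; apply: ler_sum => l _.
  rewrite normrM normrX (gtr0_norm x0); apply: ler_wpM2r; first by rewrite exprn_ge0 // ltW.
  by rewrite coefB ltW.
have hW i j : `|(U *m D *m V) i j| <= n%:R * (m%:R * (MU * (eps * G)) * MV).
  rewrite mxE; apply: le_trans (ler_norm_sum _ _ _) _.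
  rewrite mulr_natl -[X in _ *+ X]card_ord -sumr_const; apply: ler_sum => l _.
  rewrite normrM; apply: ler_pM => //; rewrite mxE.
  apply: le_trans (ler_norm_sum _ _ _) _.
  rewrite mulr_natl -[X in _ *+ X]card_ord -sumr_const; apply: ler_sum => l' _.
  by rewrite normrM; apply: ler_pM.
have : row_free (c%:M - U *m D *m V).
  apply: near_scalar_free hW _.
  have -> : r.+1%:R * (n%:R * (m%:R * (MU * (eps * G)) * MV)) = eps * Z by rewrite /Z; ring.
  by rewrite /eps mulrAC ltr_pdivrMr // mulrDr mulr1 ltrDl.
have -> : c%:M - U *m D *m V = U *m ev _ _ Q *m V.
  by rewrite /D mulmxBr mulmxBl E opprB addrCA subrr addr0.
have [L [R ->]] := hS _ SQ; rewrite /ev map_mxM /row_free => /eqP rk.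
have : (r.+1 <= r)%N; last by rewrite ltnn.
rewrite -{1}rk mulmxA -mulmxA; apply: leq_trans (mxrankM_maxl _ _) _.
exact: rank_leq_col.
Qed.

(** * Comparison of the closures *)

Section Closures.

Variables (m n r d : nat).
Hypotheses (r0 : (0 < r)%N) (rmn : (r < minn m n)%N).

Lemma Bset_deg_le a (Q : 'M[{poly C}]_(m, n)) :
  (a <= r * d)%N -> Bset r d a Q -> deg_le Q d.
Proof. by move=> ard /Bset_prodset; apply: prodset_deg_le => i; apply: target_le. Qed.

Lemma closure_d_mono (S T : 'M[{poly C}]_(m, n) -> Prop) P :
  (forall Q, S Q -> T Q) -> closure_d d S P -> closure_d d T P.
Proof.
move=> ST [dP h]; split=> // eps e0; have [Q [SQ hQ]] := h _ e0.
by exists Q; split; first exact: ST.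
Qed.

Lemma closure_Bset_MHset a P : (a <= r * d)%N ->
  closure_d d (Bset r d a) P -> closure_d d (@MHset m n r d a) P.
Proof.
move=> ard clP; have [dP _] := clP; apply: approx_closure => //.
apply: approx_trans (closure_approx (fun Q => @Bset_deg_le a Q ard) clP) _ => Q BQ.
exact: prodset_approx_MHset r0 rmn ard _ (Bset_prodset BQ).
Qed.

Lemma PolyMat_closure_MHset (P : 'M[{poly C}]_(m, n)) :
  PolyMat_dr d r P -> exists2 a, (a <= r * d)%N & closure_d d (MHset r d a) P.
Proof.
move=> [dP rP]; have rn : (r <= n)%N by move: rmn; rewrite ltn_min => /andP[_ /ltnW].
have [e ed hP] := factor_exists dP rP rn.
have ard : (\sum_i e i <= r * d)%N.
  have <- : (\sum_(i < r) d = r * d)%N by rewrite sum_nat_const card_ord.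
  exact: leq_sum.
(* The integer a is the sum of the row degree bounds of a factorization, which balancing
   preserves. *)
exists (\sum_i e i)%N => //; apply: approx_closure => //.
apply: approx_trans (_ : approx (prodset d (@target r (\sum_i e i))) P) _.
  apply: (prodset_balance ed) hP; last by rewrite sum_target.
  by move=> i j; rewrite /target; do 2!case: ifP => _; lia.
exact: prodset_approx_MHset.
Qed.

Lemma closure_Bset_PolyMat a P : (a <= r * d)%N ->
  closure_d d (@Bset m n r d a) P -> PolyMat_dr d r P.
Proof.
move=> ard clP; have [dP _] := clP; split=> //.
apply: (approx_rank (fun Q => @Bset_deg_le a Q ard) dP) (closure_approx _ clP).
  by move=> Q [L [R [_ ->]]]; exists L, R.
by move=> Q; apply: Bset_deg_le.
Qed.

End Closures.

Theorem theorem4p11 (m n r d : nat) :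
  (2 <= m)%N -> (2 <= n)%N -> (1 <= d)%N -> (0 < r)%N -> (r < minn m n)%N ->
  (* (i) *)
  (forall a, (a <= r * d)%N ->
     (forall P : 'M[{poly C}]_(m, n), MHset r d a P -> Mset r d a P) /\
     (forall P : 'M[{poly C}]_(m, n), Mset r d a P -> Bset r d a P)) /\
  (* (ii) *)
  (forall a, (a <= r * d)%N ->
     forall P : 'M[{poly C}]_(m, n),
       (closure_d d (MHset r d a) P <-> closure_d d (Mset r d a) P) /\
       (closure_d d (Mset r d a) P <-> closure_d d (Bset r d a) P)) /\
  (* (iii) *)
  (forall P : 'M[{poly C}]_(m, n),
     (PolyMat_dr d r P <->
        exists2 a, (a <= r * d)%N & closure_d d (MHset r d a) P) /\
     (PolyMat_dr d r P <->
        exists2 a, (a <= r * d)%N & closure_d d (Mset r d a) P)) /\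
  (* (iv) *)
  (forall P : 'M[{poly C}]_(m, n), PolyMat_dr d r P ->
     exists a : nat,
       closure_d d (MHset r d a) P /\
       (forall Q : 'M[{poly C}]_(m, n), closure_d d (MHset r d a) Q <->
                  closure_d d (Mset r d a) Q)).
Proof.
move=> _ _ _ r0 rmn.
have MHB a P : closure_d d (@MHset m n r d a) P -> closure_d d (Bset r d a) P.
  by apply: closure_d_mono => Q /MHset_Mset/Mset_Bset.
have MB a P : closure_d d (@Mset m n r d a) P -> closure_d d (Bset r d a) P.
  by apply: closure_d_mono => Q; apply: Mset_Bset.
have MHM a P : closure_d d (@MHset m n r d a) P -> closure_d d (Mset r d a) P.
  by apply: closure_d_mono => Q; apply: MHset_Mset.
have BMH a P (ard : (a <= r * d)%N) := @closure_Bset_MHset m n r d r0 rmn a P ard.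
split; [|split; [|split]].
- by move=> a _; split=> P; [apply: MHset_Mset|apply: Mset_Bset].
- move=> a ard P; split; split; first exact: MHM.
  + by move/MB/BMH; apply.
  + exact: MB.
  by move/BMH => /(_ ard)/MHM.
- move=> P; split; split=> [/(PolyMat_closure_MHset r0 rmn)[a ard cl]|[a ard cl]].
  + by exists a.
  + exact: closure_Bset_PolyMat r0 a P ard (MHB a P cl).
  + by exists a => //; apply: MHM.
  exact: closure_Bset_PolyMat r0 a P ard (MB a P cl).
move=> P /(PolyMat_closure_MHset r0 rmn)[a ard cl]; exists a; split=> // Q.
by split=> [/MHM//|/MB/BMH]; apply.
Qed.
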